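(* Let $s\in(0,2]$, let $P$ be a finite set of $n$ points in $(\mathbb{R}^d,\ell_s)$, and let $r,\varepsilon>0$. The data structure $\mathcal{A}'(P,r,\varepsilon)$ (described in the context) answers exhaustive $r$-PLEB queries correctly with high probability in expected $$\tilde O\!\left(\frac{n^\varrho}{p_1}\left(\frac{1}{\ln(1/p_2)}+1\right)+\frac{n^\alpha}{p_1}\,|N_P(q,r(1+\varepsilon))|\right)$$ time using $\tilde O\!\left(\frac{n^{1+\varrho}}{p_1}\right)$ space, where $\varrho=\frac{\ln p_1}{\ln p_2}$ and $\alpha=\varrho\left(1-\frac{\ln p_0}{\ln p_1}\right)\le\varrho$, with $p_0=\Phi\!\left(\frac{1}{1+\varepsilon}\right)$, $p_1=\Phi(1)$, $p_2=\Phi\!\left(((1+\varepsilon)^s+(1+\varepsilon)^{-s}-1)^{1/s}\right)$.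
   Context: $\mathrm{d}(x,y)=(\sum_i|x_i-y_i|^s)^{1/s}$. $N_P(x,R)$ is the set of points of $P\setminus\{x\}$ at distance at most $R$ from $x$; the exhaustive $r$-PLEB query asks, given $q$, to return $N_P(q,r)$. Hash family: a distribution $D$ on $\mathbb{R}$ is $s$-stable if for i.i.d. $X_1,\dots,X_m\sim D$ and reals $\alpha_i$, $\sum_i\alpha_iX_i$ has the law of $(\sum_i|\alpha_i|^s)^{1/s}X$ with $X\sim D$. Fix an $s$-stable $D$ and $w>0$; for $a\in\mathbb{R}^m$ with i.i.d. $D$ coordinates and $b$ uniform on $[0,w)$, let $f_{a,b}(x)=\lfloor (a\cdot x+b)/w\rfloor$. Two points at distance $l$ collide with probability $\Phi(l)=\int_0^w \frac1l f_D(t/l)(1-t/w)\,dt$, where $f_D$ is the density of $|X|$, $X\sim D$; $\Phi$ is decreasing. Structure $\mathcal{A}(Q,1,\varepsilon')$ on a finite $Q\subset\mathbb{R}^{m}$ with $N=|Q|$: with $\pi_1=\Phi(1)$, $\pi_2=\Phi(1+\varepsilon')$, $\varrho'=\ln\pi_1/\ln\pi_2$, $k=\lceil\ln N/\ln(1/\pi_2)\rceil$, $L=\lceil N^{\varrho'}/\pi_1\rceil$, for each of $\lceil c\ln N\rceil$ rounds ($c>0$ fixed constant) draw $L$ independent vectors $g_j=(f_1,\dots,f_k)$ of independent random functions $f_{a,b}$ and store each point of $Q$ in table $H_j$ under key $g_j(\cdot)$; a query $q$ retrieves all points stored under key $g_j(q)$ in all tables and rounds and keeps those within distance $1$ of $q$.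 Structure $\mathcal{A}'(P,r,\varepsilon)$: let $r'=r(1+\frac{1}{(1+\varepsilon)^s-1})^{1/s}$, $\varepsilon'=((1+\varepsilon)^s+(1+\varepsilon)^{-s}-1)^{1/s}-1$. Lift each $p\in P$ to $(p,0)\in\mathbb{R}^{d+1}$, rescale by $1/r'$ and build $\mathcal{A}(\cdot,1,\varepsilon')$ on the result (in $(\mathbb{R}^{d+1},\ell_s)$). A query $q$ is lifted to $(q,\, r/((1+\varepsilon)^s-1)^{1/s})$, rescaled by $1/r'$, queried in that structure, and the preimages of the output points are returned. ''Correctly with high probability'': the output equals $N_P(q,r)$ with probability at least $1-n^{1-c\ln(5/2)}$. Running time counts distance computations and hash evaluations at unit cost; $\tilde O$ hides factors polylogarithmic in $n/\varepsilon$.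
   Formalization: The query q is assumed not to belong to P: for q in P the structure would return q itself with high probability, although N_P(q,r) excludes q, so the correctness claim fails there. *)

(* Defs.v *)
From HB Require Import structures.
From mathcomp Require Import all_boot all_order all_algebra.
From mathcomp Require Import all_classical all_reals all_analysis.
Set Implicit Arguments. Unset Strict Implicit. Unset Printing Implicit Defensive.
Import Order.TTheory GRing.Theory Num.Theory.
Import numFieldNormedType.Exports.
Local Open Scope classical_set_scope.
Local Open Scope ring_scope.

Section Defs.
Variable R : realType.

Definition natceil (x : R) : nat := `|Num.ceil x|%N.

Definition dist_s (s : R) (m : nat) (x y : 'rV[R]_m) : R :=
  (\sum_(i < m) `|x 0 i - y 0 i| `^ s) `^ s^-1.

Definition has_law d (T : measurableType d) (Pr : probability T R)
  (Y : T -> R) (mu : set R -> \bar R) :=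
  forall B : set R, measurable B -> Pr (Y @^-1` B) = mu B.

Definition mutually_independent d (T : measurableType d)
  (Pr : probability T R) (I : eqType) (Y : I -> T -> R) :=
  forall (J : seq I) (B : I -> set R), uniq J ->
    (forall i, measurable (B i)) ->
    Pr (\bigcap_(i in [set` J]) (Y i @^-1` B i)) =
    (\prod_(i <- J) Pr (Y i @^-1` B i))%E.

Definition s_stable (s : R) (D : probability R R) :=
  forall (m : nat) (alpha : 'I_m -> R) d (T : measurableType d)
    (Pr : probability T R) (Y : 'I_m -> T -> R),
    (forall i, measurable_fun setT (Y i)) ->
    mutually_independent Pr Y ->
    (forall i, has_law Pr (Y i) D) ->
    has_law Pr (fun o => \sum_(i < m) alpha i * Y i o)
      (fun B => D ((fun x => (\sum_(i < m) `|alpha i| `^ s) `^ s^-1 * x) @^-1` B)).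

Definition abs_density (D : probability R R) (fD : R -> R) :=
  (forall x, 0 <= fD x) /\ measurable_fun setT fD /\
  forall B : set R, measurable B ->
    D ((fun x => `|x|) @^-1` B) = (\int[lebesgue_measure]_(x in B) (fD x)%:E)%E.

Definition unif_law (w : R) : set R -> \bar R :=
  fun B => ((lebesgue_measure (B `&` [set x : R | (0 <= x < w)%R])) * (w^-1)%:E)%E.

(** collision probability Phi(l) *)
Definition Phi (fD : R -> R) (w l : R) : R :=
  Rintegral lebesgue_measure `[0, w]%classic
    (fun t => l^-1 * fD (t / l) * (1 - t / w)).

Definition nbhd (s : R) (d : nat) (P : seq 'rV[R]_d) (x : 'rV[R]_d) (R0 : R) :=
  [seq p <- P | (p != x) && (dist_s s p x <= R0)].

Definition r'_of (s r eps : R) : R :=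
  r * (1 + ((1 + eps) `^ s - 1)^-1) `^ s^-1.
Definition eps'_of (s eps : R) : R :=
  ((1 + eps) `^ s + (1 + eps) `^ (- s) - 1) `^ s^-1 - 1.
Definition height_of (s r eps : R) : R :=
  r / ((1 + eps) `^ s - 1) `^ s^-1.

Definition lift_pt (d : nat) (h r' : R) (p : 'rV[R]_d) : 'rV[R]_(d + 1) :=
  r'^-1 *: row_mx p (const_mx h).

Definition pi1 fD w := Phi fD w 1.
Definition pi2 fD w eps' := Phi fD w (1 + eps').
Definition k_of fD w eps' (N : nat) : nat :=
  natceil (ln N%:R / ln (pi2 fD w eps')^-1).
Definition L_of fD w eps' (N : nat) : nat :=
  natceil (N%:R `^ (ln (pi1 fD w) / ln (pi2 fD w eps')) / pi1 fD w).
Definition rounds_of (c : R) (N : nat) : nat := natceil (c * ln N%:R).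

(** The randomness: X (t, j, i, l) with l <= d is coordinate l of the
    vector a of the i-th function of g_j in round t; X (t, j, i, d+1) is
    its offset b. *)
Definition hash_val d (T : Type) (X : nat * nat * nat * nat -> T -> R)
  (w : R) (o : T) (t j i : nat) (v : 'rV[R]_(d + 1)) : int :=
  Num.floor ((\sum_(l < d + 1) X (t, j, i, val l) o * v 0 l
              + X (t, j, i, (d + 1)%N) o) / w).

Definition g_key d (T : Type) (X : nat * nat * nat * nat -> T -> R)
  (w : R) (k : nat) (o : T) (t j : nat) (v : 'rV[R]_(d + 1)) : seq int :=
  [seq hash_val X w o t j i v | i <- iota 0 k].

Section Query.
Variables (s : R) (fD : R -> R) (w c : R) (d : nat) (T : Type)
  (X : nat * nat * nat * nat -> T -> R)
  (P : seq 'rV[R]_d) (r eps : R) (q : 'rV[R]_d).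

Let N := size P.
Let r' := r'_of s r eps.
Let eps' := eps'_of s eps.
Let kk := k_of fD w eps' N.
Let LL := L_of fD w eps' N.
Let TT := rounds_of c N.
Let lp (p : 'rV[R]_d) := lift_pt 0 r' p.
Let lq := lift_pt (height_of s r eps) r' q.

Definition n_hits (o : T) (p : 'rV[R]_d) : nat :=
  \sum_(t < TT) \sum_(j < LL)
     (g_key X w kk o t j (lp p) == g_key X w kk o t j lq).

Definition query_output (o : T) : seq 'rV[R]_d :=
  [seq p <- P | (0 < n_hits o p)%N && (dist_s s (lp p) lq <= 1)].

(** running time: hash evaluations (k per table) plus one distance
    computation per retrieved point *)
Definition query_time (o : T) : nat :=
  (TT * LL * kk + \sum_(p <- P) n_hits o p)%N.

(** space: number of stored entries *)
Definition ds_space : nat := (TT * LL * N)%N.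
End Query.

End Defs.

(* Main.v *)
Require Import Defs.
From HB Require Import structures.
From mathcomp Require Import all_boot all_order all_algebra.
From mathcomp Require Import all_classical all_reals all_analysis.
From mathcomp Require Import measurable_realfun.
From mathcomp Require Import zify ring lra.
Import Order.TTheory GRing.Theory Num.Theory.
Import numFieldNormedType.Exports.
Local Open Scope classical_set_scope.
Local Open Scope ring_scope.

(** For a fixed table, the law of [a . x - a . y] is that of [l X], [l] the
    [l_s] distance, by stability; averaging over the uniform offset [b] gives
    the collision probability [E max(0, 1 - l |X| / w) = Phi l]. This formula
    makes the monotonicity of [Phi] and [Phi l < 1] evident; [Phi l > 0] holds
    because [X_1 - X_2] is a multiple of [X] in law and hence puts mass in each
    neighbourhood of [0]. Tables and hash functions use disjoint blocks of the
    underlying independent variables, so their match events are independent.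
    With [u = (1 + eps)^s], the lift turns [|p - q|] into [l] with
    [l^s = (|p - q|^s (u - 1) / r^s + 1) / u]: [l <= 1] iff [|p - q| <= r], all
    [l] are at least [1 / (1 + eps)], and [|p - q| > r (1 + eps)] forces
    [l^s >= u + 1/u - 1]. The rest is the usual LSH count:
    [p2^k <= 1/n], [p1^k >= p1 n^(-rho)], [p0^k <= n^(alpha - rho)]. *)

Set Implicit Arguments.
Unset Strict Implicit.
Unset Printing Implicit Defensive.

(** * Independence of blocks *)

Section BlockIndependence.
Context d (T : measurableType d) (R : realType) (Pr : probability T R).
Context (I : eqType) (X : I -> T -> R).
Hypothesis mX : forall i, measurable_fun setT (X i).
Hypothesis indX : mutually_independent Pr X.

(** The pi-system of finite-dimensional events generating the sigma-algebra of the variables indexed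
    by [S]. [B] is total to fit [mutually_independent]; only its values on [J] matter. *)
Definition cylinders (S : set I) : set (set T) :=
  [set A | exists (J : seq I) (B : I -> set R),
    [/\ [set` J] `<=` S, (forall i, measurable (B i)) &
        A = \bigcap_(i in [set` J]) (X i @^-1` B i)]].

Lemma measurable_preimage (i : I) (B : set R) :
  measurable B -> measurable (X i @^-1` B).
Proof. by move=> mB; rewrite -[_ @^-1` _]setTI; exact: mX. Qed.

Lemma cylinders_measurable S : cylinders S `<=` measurable.
Proof.
move=> A [J [B [_ mB ->]]]; apply: fin_bigcap_measurable => // i _.
exact: measurable_preimage.
Qed.

Lemma sigma_cylinders_measurable S : <<s cylinders S >> `<=` measurable.
Proof.
apply: smallest_sub; last exact: cylinders_measurable.
exact: sigma_algebra_measurable.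
Qed.

Lemma cylindersT S : cylinders S setT.
Proof.
by exists [::], (fun=> setT); rewrite set_nil bigcap_set0; split.
Qed.

Let glue (J J' : seq I) (B B' : I -> set R) i :=
  (if i \in J then B i else setT) `&` (if i \in J' then B' i else setT).

Let measurable_glue (J J' : seq I) B B' : (forall i, measurable (B i)) ->
  (forall i, measurable (B' i)) -> forall i, measurable (glue J J' B B' i).
Proof. by move=> mB mB' i; apply: measurableI; case: ifP. Qed.

Let bigcap_glue J J' B B' :
  (\bigcap_(i in [set` J]) (X i @^-1` B i)) `&`
  (\bigcap_(i in [set` J']) (X i @^-1` B' i)) =
  \bigcap_(i in [set` undup (J ++ J')]) (X i @^-1` glue J J' B B' i).
Proof.
apply/seteqP; split=> [x [oJ oJ'] i _|x oJJ'].
  rewrite /glue; split.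
    by case: ifPn => // iJ; exact: oJ.
  by case: ifPn => // iJ; exact: oJ'.
split=> i /= iJ; have /oJJ' [] : i \in undup (J ++ J').
- by rewrite mem_undup mem_cat iJ.
- by rewrite iJ.
- by rewrite mem_undup mem_cat iJ orbT.
- by move=> _; rewrite iJ.
Qed.

Lemma cylinders_setI_closed S : setI_closed (cylinders S).
Proof.
move=> _ _ [J [B [JS mB ->]]] [J' [B' [JS' mB' ->]]].
exists (undup (J ++ J')), (glue J J' B B'); split => //.
- by move=> i /=; rewrite mem_undup mem_cat => /orP[/JS|/JS'].
- exact: measurable_glue.
Qed.

(** Since the blocks are disjoint, [glue] returns [B] on [J] and [B'] on [J'], so the product over
    the concatenated list splits. Lists are deduplicated because independence is stated for
    duplicate-free ones. *)
Lemma indep_cylinders S S' A A' : [disjoint S & S'] ->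
  cylinders S A -> cylinders S' A' -> Pr (A `&` A') = (Pr A * Pr A')%E.
Proof.
move=> disj [J [B [JS mB ->]]] [J' [B' [JS' mB' ->]]].
have undupE (K : seq I) (C : I -> set R) : \bigcap_(i in [set` K]) (X i @^-1` C i)
    = \bigcap_(i in [set` undup K]) (X i @^-1` C i).
  by congr bigcap; apply/seteqP; split=> i /=; rewrite mem_undup.
have JJ' i : i \in J -> i \in J' -> False.
  move=> /JS iS /JS' iS'; move/disj_setPS : disj => /(_ i); exact.
rewrite bigcap_glue indX ?undup_uniq//; last exact: measurable_glue.
rewrite [in RHS]undupE [X in (_ * Pr X)%E]undupE !indX ?undup_uniq//.
rewrite (_ : undup (J ++ J') = undup J ++ undup J'); last first.
  rewrite undup_cat; congr (_ ++ _); apply/all_filterP/allP => i.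
  by rewrite mem_undup => iJ /=; apply/negP => /(JJ' i iJ).
rewrite big_cat/=; congr (_ * _)%E; apply: eq_big_seq => i;
  rewrite mem_undup => iJ; rewrite /glue iJ.
- by case: ifPn => [/(JJ' i iJ)//|_]; rewrite setIT.
- by case: ifPn => [/JJ'/(_ iJ)//|_]; rewrite setTI.
Qed.

(** With [A'] fixed, both sides are finite measures in [A] that agree on a pi-system containing the
    whole space, hence on the sigma-algebra it generates. *)
Let indep_extend (G : set (set T)) A' : G `<=` measurable -> setI_closed G ->
  G setT -> measurable A' ->
  (forall A, G A -> Pr (A `&` A') = (Pr A * Pr A')%E) ->
  forall A, <<s G >> A -> Pr (A `&` A') = (Pr A * Pr A')%E.
Proof.
move=> Gm GI GT mA' GA A sA.
have p0 : 0 <= fine (Pr A') by rewrite fine_ge0.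
have PA' : (Pr A' = (fine (Pr A'))%:E)%E by rewrite fineK// fin_num_measure.
have /= := @g_sigma_algebra_measure_unique _ _ _ G Gm (fun=> setT)
   (fun=> GT) _ (mrestr Pr mA') (mscale (NngNum p0) Pr) GI _ _ A sA.
rewrite /mrestr /mscale/= -PA' muleC; apply.
- by rewrite bigcup_const.
- by move=> B /GA; rewrite muleC.
- move=> _; rewrite setTI; exact: (le_lt_trans (probability_le1 _ _) (ltry _)).
Qed.

(** The extension is applied once to each factor, the other one being held fixed. *)
Lemma indep_sigma_cylinders S S' A A' : [disjoint S & S'] ->
  <<s cylinders S >> A -> <<s cylinders S' >> A' ->
  Pr (A `&` A') = (Pr A * Pr A')%E.
Proof.
move=> disj sA sA'; apply: (indep_extend (G := cylinders S)) => //.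
- exact: cylinders_measurable.
- exact: cylinders_setI_closed.
- exact: cylindersT.
- exact: sigma_cylinders_measurable sA'.
move=> B SB; rewrite setIC muleC; apply: (indep_extend (G := cylinders S')) => //.
- exact: cylinders_measurable.
- exact: cylinders_setI_closed.
- exact: cylindersT.
- exact: cylinders_measurable SB.
by move=> B' SB'; rewrite setIC muleC; exact: indep_cylinders SB SB'.
Qed.

Lemma sigma_cylindersS S S' : S `<=` S' ->
  <<s cylinders S >> `<=` <<s cylinders S' >>.
Proof.
move=> SS'; apply: sub_smallest2r; first exact: smallest_sigma_algebra.
move=> A [J [B [JS mB ->]]].
by exists J, B; split => //; exact: subset_trans SS'.
Qed.

Lemma block_independence (I' : eqType) (S : I' -> set I) (A : I' -> set T)
    (J : seq I') : uniq J ->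
  (forall b b', b \in J -> b' \in J -> b != b' -> [disjoint S b & S b']) ->
  (forall b, b \in J -> <<s cylinders (S b) >> (A b)) ->
  Pr (\bigcap_(b in [set` J]) A b) = (\prod_(b <- J) Pr (A b))%E.
Proof.
(* The induction must also carry measurability of the intersection with respect to the union of the
   blocks, so that it is independent of the next event. *)
suff H : uniq J ->
  (forall b b', b \in J -> b' \in J -> b != b' -> [disjoint S b & S b']) ->
  (forall b, b \in J -> <<s cylinders (S b) >> (A b)) ->
  <<s cylinders (\bigcup_(b in [set` J]) S b) >> (\bigcap_(b in [set` J]) A b)
  /\ Pr (\bigcap_(b in [set` J]) A b) = (\prod_(b <- J) Pr (A b))%E.
  by move=> u disj sA; case: (H u disj sA).
elim: J => [_ _ _|b J ih /= /andP[bJ uJ] disj sA].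
  rewrite set_nil bigcap_set0 big_nil probability_setT; split => //.
  by apply: sub_gen_smallest; exact: cylindersT.
have [] := ih uJ _ _.
- by move=> b1 b2 b1J b2J; apply: disj; rewrite inE ?b1J ?b2J orbT.
- by move=> b1 b1J; apply: sA; rewrite inE b1J orbT.
move=> sJ PJ.
rewrite (_ : [set` b :: J] = b |` [set` J]); last first.
  by apply/seteqP; split=> i /=; rewrite inE => /predU1P.
rewrite bigcap_setU1 bigcup_setU1 big_cons -PJ.
have sAb := sA b (mem_head _ _); split.
  pose S' := S b `|` \bigcup_(i in [set` J]) S i.
  apply: (@measurableI _ (g_sigma_algebraType (cylinders S'))).
    by apply: sigma_cylindersS sAb; exact: subsetUl.
  by apply: sigma_cylindersS sJ; exact: subsetUr.
apply: (indep_sigma_cylinders _ sAb sJ).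
apply/disj_setPS => i [Sbi [b' /= b'J Sb'i]].
have b'J1 : b' \in b :: J by rewrite inE b'J orbT.
have bb' : b != b' by apply: contraNneq bJ => ->.
by have /disj_setPS/(_ i) := disj b b' (mem_head _ _) b'J1 bb'; apply.
Qed.

End BlockIndependence.

(** * Densities and laws *)

Section Density.
Local Open Scope ereal_scope.
Import HBNNSimple.

(** Change of measure: given on indicators by assumption, it passes to simple functions by linearity
    and to [g] by monotone convergence. *)
Lemma ge0_integral_density d (T : measurableType d) (R : realType)
    (mu nu : {measure set T -> \bar R}) (f : T -> R) (A : set T)
    (g : T -> \bar R) :
  measurable_fun setT f -> (forall x, (0 <= f x)%R) ->
  (forall B, measurable B -> nu B = \int[mu]_(x in B) (f x)%:E) ->
  measurable A -> measurable_fun A g -> (forall x, A x -> 0 <= g x) ->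
  \int[nu]_(x in A) g x = \int[mu]_(x in A) (g x * (f x)%:E).
Proof.
move=> mf f0 nuE mA mg g0.
pose g_ := nnsfun_approx mA mg.
have mfA : measurable_fun A (EFin \o f).
  by apply/measurable_EFinP; exact: measurable_funTS.
transitivity (limn (fun n => \int[nu]_(x in A) (g_ n x)%:E)).
  rewrite -monotone_convergence//.
  - by apply: eq_integral => x /[!inE] xA; apply/esym/cvg_lim => //;
      exact: cvg_nnsfun_approx.
  - by move=> n; exact/measurable_EFinP/measurable_funTS.
  - by move=> n x _; rewrite lee_fin.
  - by move=> x _ m n mn; rewrite lee_fin; exact/lefP/nd_nnsfun_approx.
transitivity (limn (fun n => \int[mu]_(x in A) ((g_ n x)%:E * (f x)%:E))).
  congr (limn _); apply/funext => n.
  transitivity (\sum_(r \in range (g_ n))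
      \int[nu]_(x in A) (r * \1_(g_ n @^-1` [set r]) x)%:E).
    under eq_integral do rewrite fimfunE -fsumEFin//.
    rewrite ge0_integral_fsum//.
    - by move=> r; exact/measurable_EFinP/measurable_funM.
    - by move=> r x _; rewrite nnfun_muleindic_ge0.
  transitivity (\sum_(r \in range (g_ n))
      \int[mu]_(x in A) ((r * \1_(g_ n @^-1` [set r]) x)%:E * (f x)%:E)).
    apply: eq_fsbigr => r /[!inE] -[y _ gy].
    have r0 : (0 <= r)%R by rewrite -gy.
    have mr : measurable (g_ n @^-1` [set r]) by [].
    under eq_integral do rewrite EFinM.
    under [RHS]eq_integral do rewrite EFinM -muleA.
    rewrite ge0_integralZl_EFin//; last exact/measurable_EFinP/measurable_indic.
    rewrite ge0_integralZl_EFin//; last 2 first.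
    - by move=> x _; rewrite mule_ge0// lee_fin.
    - by apply: emeasurable_funM => //; exact/measurable_EFinP/measurable_indic.
    congr (_ * _); rewrite integral_indic// nuE; last exact: measurableI.
    rewrite setIC integral_mkcondr; apply: eq_integral => x _.
    rewrite epatch_indic muleC; congr (_ * _).
  rewrite -ge0_integral_fsum//.
  - apply: eq_integral => x _.
    rewrite [in RHS]fimfunE -fsumEFin// ge0_mule_fsuml// => r.
    by rewrite ?EFinM nnfun_muleindic_ge0.
  - move=> r; apply: emeasurable_funM => //.
    exact/measurable_EFinP/measurable_funM.
  - move=> r x _; rewrite mule_ge0 ?lee_fin// -?lee_fin ?EFinM.
    by rewrite nnfun_muleindic_ge0.
rewrite -monotone_convergence//.
- apply: eq_integral => x /[!inE] xA; apply/cvg_lim => //.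
  apply: cvgeZr => //; exact: cvg_nnsfun_approx.
- move=> n; apply: emeasurable_funM => //.
  exact/measurable_EFinP/measurable_funTS.
- by move=> n x _; rewrite mule_ge0 ?lee_fin.
- move=> x _ m n mn; apply: lee_pmul => //; rewrite ?lee_fin//.
  exact/lefP/nd_nnsfun_approx.
Qed.

Definition push_measure d d' (T : measurableType d) (T' : measurableType d')
    (R : realType) (m : {measure set T -> \bar R}) (f : T -> T')
    (mf : measurable_fun setT f) : {measure set T' -> \bar R} :=
  measure_function_pushforward__canonical__measure_function_Measure m mf.

(** The scaled pushforward agrees with Lebesgue measure on half-open intervals, so uniqueness
    applies. *)
Lemma lebesgue_measure_scale (R : realType) (l : R) (l0 : (0 < l)%R) (B : set R) :
  measurable B ->
  lebesgue_measure B = l%:E * lebesgue_measure (( *%R l) @^-1` B).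
Proof.
move=> mB.
have ml : measurable_fun setT ( *%R l : measurableTypeR R -> measurableTypeR R).
  exact: mulrl_measurable.
have /= := @lebesgue_measure_unique R
  (mscale (NngNum (ltW l0)) (push_measure lebesgue_measure ml)).
rewrite /mscale/= /pushforward; apply => // _ [[a b] _ <-].
rewrite (_ : _ @^-1` _ = `](a / l)%R, (b / l)%R]%classic); last first.
  apply/seteqP; split=> x /=; rewrite !in_itv/= ltr_pdivrMr// ler_pdivlMr//;
    by rewrite ![(x * l)%R]mulrC.
rewrite !lebesgue_measure_itv/= !lte_fin ltr_pM2r ?invr_gt0//.
case: ifPn => _; last by rewrite mule0.
by rewrite -!EFinB -EFinM -mulrBl mulrCA divff ?mulr1// gt_eqF.
Qed.

Lemma ge0_integral_scale (R : realType) (l : R) (A : set R) (f : R -> \bar R) :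
  (0 < l)%R -> measurable A -> measurable_fun A f ->
  (forall x, A x -> 0 <= f x) ->
  \int[lebesgue_measure]_(x in A) f x =
  l%:E * \int[lebesgue_measure]_(x in ( *%R l) @^-1` A) f (l * x)%R.
Proof.
move=> l0 mA mf f0.
have ml : measurable_fun setT ( *%R l : measurableTypeR R -> measurableTypeR R).
  exact: mulrl_measurable.
rewrite (@eq_measure_integral _ _ _ _ (mscale (NngNum (ltW l0))
  (push_measure lebesgue_measure ml))); last first.
  by move=> B mB _; exact: lebesgue_measure_scale.
rewrite ge0_integral_mscale//= ge0_integral_pushforward//.
by move=> x /[!inE] /f0.
Qed.

End Density.

(** The probability, over a uniform offset, that two reals with difference [x] share a cell of a
    grid of width [w]. *)
Definition tent (R : realType) (w x : R) : R := Num.max 0 (1 - `|x| / w).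

Section Tent.
Context (R : realType) (w : R).
Hypothesis w0 : 0 < w.

Lemma tent_ge0 x : 0 <= tent w x.
Proof. by rewrite /tent le_max lexx. Qed.

Lemma tent_le1 x : tent w x <= 1.
Proof. by rewrite /tent ge_max ler01 gerBl divr_ge0// ltW. Qed.

Lemma measurable_tent : measurable_fun setT (@tent R w).
Proof.
apply: measurable_maxr => //; apply: measurable_funB => //.
apply: measurable_funM => //.
Qed.

End Tent.

(** Both sides integrate [g] against the same pushforward. This later replaces a difference of
    projections by a multiple of one stable variable living on another space. *)
Lemma ge0_integral_same_law d d' d'' (T : measurableType d)
    (T' : measurableType d') (Y : measurableType d'') (R : realType)
    (m : {measure set T -> \bar R}) (m' : {measure set T' -> \bar R})
    (f : T -> Y) (f' : T' -> Y) (g : Y -> \bar R) :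
  measurable_fun setT f -> measurable_fun setT f' ->
  (forall B, measurable B -> m (f @^-1` B) = m' (f' @^-1` B)) ->
  measurable_fun setT g -> (forall y, (0 <= g y)%E) ->
  (\int[m]_x g (f x) = \int[m']_x g (f' x))%E.
Proof.
move=> mf mf' ff' mg g0.
transitivity (\int[push_measure m mf]_y g y)%E.
  by rewrite (@ge0_integral_pushforward _ _ _ _ _ f).
rewrite (@eq_measure_integral _ _ _ _ (push_measure m' mf')); last first.
  by move=> B mB _; exact: ff'.
by rewrite (@ge0_integral_pushforward _ _ _ _ _ f').
Qed.

(** * Integral form of the collision probability *)

Section PhiIntegral.
Context (R : realType) (D : probability R R) (fD : R -> R) (w : R).
Hypothesis fDP : abs_density D fD.
Hypothesis w0 : 0 < w.

Lemma integral_tent_le1 d (T : measurableType d) (Pr : probability T R)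
    (f : T -> R) : measurable_fun setT f ->
  (\int[Pr]_x (tent w (f x))%:E <= 1)%E.
Proof.
move=> mf; rewrite -(@probability_setT _ _ _ Pr) -[leRHS]mul1e -integral_cst//.
apply: ge0_le_integral => //.
- by move=> x _; rewrite lee_fin tent_ge0.
- by apply/measurable_EFinP/measurableT_comp => //; exact: measurable_tent.
- by move=> x _; rewrite lee_fin tent_le1.
Qed.

(** Substituting [t = l * u] cancels [1 / l] and leaves the density of the absolute value against
    [1 - l * u / w] on [[0, w / l]]. This weight is the tent, which is even and vanishes beyond that
    interval. *)
Lemma Phi_integral (l : R) : 0 < l ->
  (Phi fD w l)%:E = (\int[D]_x (tent w (l * x))%:E)%E.
Proof.
move=> l0; have [fD0 [mfD fDE]] := fDP.
pose abs (x : R) : measurableTypeR R := `|x|.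
have mabs : measurable_fun setT abs by exact: normr_measurable.
have mG : measurable_fun setT (fun u : R => 1 - l * u / w).
  apply: measurable_funB => //; apply: measurable_funM => //.
have lw0 : 0 <= w / l by rewrite divr_ge0// ltW.
have DE : (\int[D]_x (tent w (l * x))%:E =
    \int[lebesgue_measure]_(u in `[0%R, (w / l)%R])
      ((1 - l * u / w)%:E * (fD u)%:E))%E.
  rewrite -(ge0_integral_density (mu := @lebesgue_measure R)
    (nu := push_measure D mabs)
    (g := fun u => (1 - l * u / w)%:E) mfD fD0 fDE)//; last 2 first.
  - by apply/measurable_EFinP; exact: measurable_funTS.
  - move=> x; rewrite /= in_itv/= => /andP[x0 xw].
    by rewrite lee_fin subr_ge0 ler_pdivrMr// mul1r mulrC -ler_pdivlMr.
  rewrite (ge0_integral_pushforward mabs)//; last 2 first.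
  - by apply/measurable_EFinP; exact: measurable_funTS.
  - move=> x /[!inE]; rewrite /= in_itv/= => /andP[x0 xw].
    by rewrite lee_fin subr_ge0 ler_pdivrMr// mul1r mulrC -ler_pdivlMr.
  rewrite [RHS]integral_mkcond; apply: eq_integral => x _.
  rewrite patchE; case: ifPn => [/[!inE]|/negP/[!inE]];
    rewrite /= in_itv/= normr_ge0/= /tent normrM (gtr0_norm l0).
  - move=> xw; rewrite max_r// subr_ge0 ler_pdivrMr// mul1r mulrC.
    by rewrite -ler_pdivlMr.
  - move=> /negP; rewrite -ltNge => xw; rewrite max_l// subr_le0 ler_pdivlMr//.
    by rewrite mul1r mulrC -ler_pdivrMr// ltW.
rewrite /Phi /Rintegral (@ge0_integral_scale _ l)//; last 2 first.
- apply/measurable_EFinP; apply: measurable_funTS; apply: measurable_funM.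
    apply: measurable_funM => //; apply: measurableT_comp => //.
    exact: measurable_funM.
  by apply: measurable_funB => //; exact: measurable_funM.
- move=> x; rewrite /= in_itv/= => /andP[x0 xw]; rewrite lee_fin mulr_ge0//.
    by rewrite mulr_ge0// invr_ge0 ltW.
  by rewrite subr_ge0 ler_pdivrMr// mul1r.
rewrite (_ : _ @^-1` _ = `[0, w / l]%classic); last first.
  apply/seteqP; split=> x /=; rewrite !in_itv/= ler_pdivlMr// mulrC.
    by move=> /andP[x0 ->]; rewrite andbT -(pmulr_rge0 _ l0) mulrC.
  by move=> /andP[x0 ->]; rewrite andbT mulr_ge0// ltW.
rewrite -ge0_integralZl_EFin//; last 3 first.
- move=> x; rewrite /= in_itv/= => /andP[x0 xw]; rewrite lee_fin mulr_ge0//.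
    by rewrite mulr_ge0// invr_ge0 ltW.
  by rewrite subr_ge0 ler_pdivrMr// mul1r mulrC -ler_pdivlMr.
- apply/measurable_EFinP; apply: measurable_funTS; apply: measurable_funM => //.
  apply: measurable_funM => //; apply: measurableT_comp => //.
  by apply: measurable_funM => //; exact: mulrl_measurable.
- exact: ltW.
(* [Rintegral] is the [fine] part of an extended integral, which must therefore be shown finite; the
   bound by 1 does this. *)
rewrite (_ : (\int[_]_(x in _) _)%E = \int[D]_x (tent w (l * x))%:E)%E.
  rewrite fineK// ge0_fin_numE; last first.
    by apply: integral_ge0 => x _; rewrite lee_fin tent_ge0.
  apply: (@le_lt_trans _ _ 1%E); last exact: ltry.
  by apply: integral_tent_le1; exact: mulrl_measurable.
rewrite DE; apply: eq_integral => u _.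
rewrite -!EFinM; congr (_%:E).
rewrite (_ : l * u / l = u); last by rewrite mulrAC divff ?mul1r// gt_eqF.
by rewrite !mulrA divff ?mul1r ?gt_eqF// [LHS]mulrC.
Qed.

End PhiIntegral.

(** * Collision probability *)

Section FloorCollision.
Context (R : realType).

(** A countable union, over the cells [z], of the events that both values lie in cell [z]; [pickle]
    enumerates the integers. *)
Lemma measurable_floor_eq d (T : measurableType d) (f g : T -> R) :
  measurable_fun setT f -> measurable_fun setT g ->
  measurable [set x | Num.floor (f x) = Num.floor (g x)].
Proof.
move=> mf mg.
pose S (h : T -> R) (z : int) := h @^-1` [set` `[z%:~R : R, (z + 1)%:~R[].
have SE h z x : S h z x <-> Num.floor (h x) = z.
  by rewrite /S /= in_itv/= -floor_eq; split=> [/eqP//|->].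
have mS h : measurable_fun setT h -> forall z, measurable (S h z).
  by move=> mh z; rewrite /S -[_ @^-1` _]setTI; exact: mh.
rewrite (_ : mkset _ = \bigcup_n
    (if unpickle n is Some z then S f z `&` S g z else set0)).
  apply: bigcupT_measurable => n; case: unpickle => // z.
  by apply: measurableI; exact: mS.
apply/seteqP; split=> [x /= fg|x [n _]].
  have [z fz] : exists z, z = Num.floor (f x) by exists (Num.floor (f x)).
  exists (pickle z); first exact: I.
  by rewrite pickleK; split; apply/SE; rewrite -?fg fz.
by case: unpickle => // z [/SE fz /SE gz] /=; rewrite fz gz.
Qed.

Context (w : R).
Hypothesis w0 : 0 < w.

Let S (y y' : R) :=
  [set b | Num.floor ((y + b) / w) = Num.floor ((y' + b) / w)] `&`
  [set b : R | 0 <= b < w].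

Let in_S (y y' b : R) (z : int) : z%:~R * w <= y + b < (z + 1)%:~R * w ->
  z%:~R * w <= y' + b < (z + 1)%:~R * w ->
  Num.floor ((y + b) / w) = Num.floor ((y' + b) / w).
Proof.
rewrite -!ler_pdivlMr// -!ltr_pdivrMr// -!floor_eq => /eqP-> /eqP->//.
Qed.

Let S_in (y y' b : R) :
  Num.floor ((y + b) / w) = Num.floor ((y' + b) / w) ->
  exists z : int, z%:~R * w <= y + b < (z + 1)%:~R * w /\
                  z%:~R * w <= y' + b < (z + 1)%:~R * w.
Proof.
move=> e; exists (Num.floor ((y + b) / w)).
rewrite -!ler_pdivlMr// -!ltr_pdivrMr//; split; first exact: floor_itv.
by rewrite e; exact: floor_itv.
Qed.

Let measure_S_le (y y' : R) : y <= y' ->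
  lebesgue_measure (S y y') = (w * tent w (y - y'))%:E.
Proof.
move=> yy'.
(* As [b] runs over [0, w), the cell of [y + b] is [m] or [m + 1]. *)
set m := Num.floor (y / w); set M : R := m%:~R * w.
have [My yM] : M <= y /\ y < M + w.
  have /andP[] := floor_itv (y / w).
  by rewrite ler_pdivlMr// ltr_pdivrMr// intrD mulrDl mul1r.
have zE (z : int) b y1 : z%:~R * w <= y1 + b -> y1 < M + w -> b < w ->
    (z <= m + 1)%R.
  move=> h1 h2 h3; rewrite -ltzD1.
  rewrite -(ltr_int R) -(ltr_pM2r w0).
  by apply: le_lt_trans h1 _; rewrite !intrD !mulrDl mul1r -/M; lra.
have zE' (z : int) b : (z + 1)%:~R * w > y' + b -> 0 <= b -> (m <= z)%R.
  move=> h1 h2; rewrite -ltzD1.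
  by rewrite -(ltr_int R) -(ltr_pM2r w0) -/M; apply: le_lt_trans h1; lra.
have zcase (z : int) b : z%:~R * w <= y + b -> (z + 1)%:~R * w > y' + b ->
    0 <= b < w -> z = m \/ z = m + 1.
  move=> h1 h2 /andP[b0 bw]; have := zE _ _ _ h1 yM bw; have := zE' _ _ h2 b0.
  by lia.
have Mm1 : (m + 1)%:~R * w = M + w by rewrite intrD mulrDl mul1r.
have Mm2 : (m + 1 + 1)%:~R * w = M + w + w by rewrite intrD mulrDl mul1r Mm1.
have wt : w * tent w (y - y') = Num.max 0 (w - (y' - y)).
  rewrite /tent ler0_norm ?subr_le0// opprB maxr_pMr ?mulr0 ?(ltW w0)//.
  by rewrite mulrBr mulr1 mulrC divfK ?gt_eqF.
(* Points at least [w] apart never share a cell. *)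
rewrite wt; have [wd|dw] := leP w (y' - y).
  rewrite max_l ?subr_le0// (_ : S y y' = set0) ?measure0//.
  apply/seteqP; split=> // b [/= /S_in[z [/andP[h1 h2] /andP[h3 h4]]] _].
  by move: h4; rewrite intrD mulrDl mul1r; lra.
rewrite max_r ?subr_ge0 ?(ltW dw)//.
(* If [y' <= M + w], collisions occur on an initial piece, with both points still in cell [m], and
   on a final piece, with both in cell [m + 1]. *)
have [small|big] := leP (y' - M) w.
  rewrite (_ : S y y' = `[0, w + M - y'[ `|` `[w + M - y, w[)%classic.
    rewrite measureU//=; last first.
      apply/seteqP; split=> // b [] /=; rewrite !in_itv/=.
      by move=> /andP[_ b1] /andP[b2 _]; lra.
    rewrite !lebesgue_measure_itv/= !lte_fin.
    by have [h1|h1] := ltP; have [h2|h2] := ltP;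
      rewrite ?add0e ?adde0 -?EFinB -?EFinD; congr (_%:E); lra.
  apply/seteqP; split=> b.
    move=> [/= /S_in[z [/andP[h1 h2] /andP[h3 h4]]] bw].
    move: (bw) => /andP[b0 b1].
    have [zm|zm] := zcase _ _ h1 h4 bw; move: h1 h2 h3 h4;
      rewrite zm ?Mm1 ?Mm2 -?/M.
      by move=> *; left; rewrite /= in_itv/=; lra.
    by move=> *; right; rewrite /= in_itv/=; lra.
  move=> [|] /=; rewrite in_itv/= => /andP[h1 h2]; split; rewrite /=; try lra.
    by apply: (@in_S _ _ _ m); rewrite Mm1 -/M; lra.
  by apply: (@in_S _ _ _ (m + 1)); rewrite Mm1 Mm2; lra.
(* Here [y'] starts in cell [m + 1], so collisions run from the entry of [y + b] into that cell to
   the exit of [y' + b] from it. *)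
rewrite (_ : S y y' = `[w + M - y, w + w + M - y'[)%classic.
  rewrite !lebesgue_measure_itv/= !lte_fin.
  have [h1|h1] := ltP; last by exfalso; lra.
  by rewrite -?EFinB; congr (_%:E); lra.
apply/seteqP; split=> b.
  move=> [/= /S_in[z [/andP[h1 h2] /andP[h3 h4]]] bw].
  move: (bw) => /andP[b0 b1].
  by have [zm|zm] := zcase _ _ h1 h4 bw; move: h1 h2 h3 h4;
    rewrite zm ?Mm1 ?Mm2 -?/M => *; rewrite /= in_itv/=; lra.
rewrite /= in_itv/= => /andP[h1 h2]; split; rewrite /=; last lra.
by apply: (@in_S _ _ _ (m + 1)); rewrite Mm1 Mm2; lra.
Qed.

Lemma measure_floor_collision (y y' : R) :
  lebesgue_measure
    ([set b | Num.floor ((y + b) / w) = Num.floor ((y' + b) / w)] `&`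
     [set b : R | 0 <= b < w]) = (w * tent w (y - y'))%:E.
Proof.
have [yy'|/ltW y'y] := leP y y'; first exact: measure_S_le.
rewrite /tent distrC -[Num.max _ _]/(tent w (y' - y)) -measure_S_le//.
congr lebesgue_measure; apply/seteqP.
by split=> b [] /= e; split.
Qed.

End FloorCollision.

(** By uniqueness of product measures the joint law is the product of the marginals, and it is then
    evaluated through sections over [Y]. *)
Lemma independent_pair d d1 d2 (T : measurableType d) (T1 : measurableType d1)
    (T2 : measurableType d2) (R : realType) (Pr : probability T R)
    (Y : T -> T1) (Z : T -> T2) (E : set (T1 * T2)) :
  measurable_fun setT Y -> measurable_fun setT Z ->
  (forall A B, measurable A -> measurable B ->
    Pr (Y @^-1` A `&` Z @^-1` B) = (Pr (Y @^-1` A) * Pr (Z @^-1` B))%E) ->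
  measurable E ->
  Pr [set o | E (Y o, Z o)] = (\int[Pr]_o Pr (Z @^-1` xsection E (Y o)))%E.
Proof.
move=> mY mZ indep mE.
pose Y' : {mfun T >-> T1} := HB.pack Y (isMeasurableFun.Build _ _ _ _ Y mY).
pose Z' : {mfun T >-> T2} := HB.pack Z (isMeasurableFun.Build _ _ _ _ Z mZ).
have mYZ : measurable_fun setT (fun o => (Y o, Z o)).
  exact: measurable_fun_pair.
transitivity (push_measure Pr mYZ E); first by [].
rewrite -(@product_measure_unique _ _ _ _ _
  (distribution Pr Y') (distribution Pr Z') (push_measure Pr mYZ) indep E mE).
rewrite /product_measure1 ge0_integral_pushforward//.
exact: measurable_fun_xsection.
Qed.

Section CylinderMeasurability.
Context d (T : measurableType d) (R : realType) (I : eqType) (X : I -> T -> R).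

Lemma measurable_cylinders (S : set I) (i : I) : S i ->
  measurable_fun setT (X i : g_sigma_algebraType (cylinders X S) -> R).
Proof.
move=> Si _ B mB; rewrite setTI; apply: sub_gen_smallest.
exists [:: i], (fun=> B); split => //.
- by move=> j /=; rewrite inE => /eqP->.
- apply/seteqP; split=> [x XB j|x XB]; first by rewrite /= inE => /eqP->.
  by apply: (XB i); rewrite /= inE.
Qed.

Lemma mutually_independent_inj (Pr : probability T R) (I' : eqType)
    (f : I' -> I) : injective f -> mutually_independent Pr X ->
  mutually_independent Pr (X \o f).
Proof.
move=> fI indX J B uJ mB.
(* The test sets are transported along [f], with [setT] off its image. *)
pose B' x := if pselect (exists i, f i = x) is left e
  then B (projT1 (cid e)) else setT.
have B'E i : B' (f i) = B i.
  rewrite /B'; case: pselect => [e|[]]; last by exists i.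
  by case: cid => j /= /fI ->.
have mB' x : measurable (B' x) by rewrite /B'; case: pselect.
have := indX (map f J) B' _ mB'; rewrite map_inj_uniq// => /(_ uJ).
rewrite big_map; under eq_bigr do rewrite B'E.
move=> <-; congr (Pr _); apply/seteqP; split=> x XB i /=.
  by move=> /mapP[j jJ ->]; rewrite /= B'E; exact: XB.
by move=> iJ; have := XB (f i); rewrite /= B'E; apply; exact: map_f.
Qed.

End CylinderMeasurability.

(** * Collision probability of one hash function *)

Section Collision.
Context (R : realType) (s : R) (D : probability R R) (fD : R -> R) (w : R).
Context dO (Om : measurableType dO) (Pr : probability Om R).
Context (X : nat * nat * nat * nat -> Om -> R) (d : nat).
Hypothesis w0 : 0 < w.
Hypothesis stD : s_stable s D.
Hypothesis fDP : abs_density D fD.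
Hypothesis mX : forall i, measurable_fun setT (X i).
Hypothesis indX : mutually_independent Pr X.
Hypothesis lawX : forall t j i l, (l <= d)%N -> has_law Pr (X (t, j, i, l)) D.
Hypothesis lawb : forall t j i,
  has_law Pr (X (t, j, i, (d + 1)%N)) (unif_law w).

Definition collision (v v' : 'rV[R]_(d + 1)) (b : nat * nat * nat) : set Om :=
  [set o | hash_val X w o b.1.1 b.1.2 b.2 v = hash_val X w o b.1.1 b.1.2 b.2 v'].

Definition hash_block (b : nat * nat * nat) : set (nat * nat * nat * nat) :=
  [set x | x.1 = b].

Lemma collision_sigma v v' b :
  <<s cylinders X (hash_block b) >> (collision v v' b).
Proof.
set G := cylinders X _.
have mXG l : measurable_fun setT (X (b, l) : g_sigma_algebraType G -> R).
  exact: measurable_cylinders.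
case: b => [[t j] i] /= in G mXG *.
have mf (u : 'rV[R]_(d + 1)) : measurable_fun setT
   ((fun o => (\sum_(l < d + 1) X (t, j, i, val l) o * u 0 l
      + X (t, j, i, (d + 1)%N) o) / w) : g_sigma_algebraType G -> R).
  apply: measurable_funM => //; apply: measurable_funD => //.
  by apply: measurable_sum => l; apply: measurable_funM.
exact: (measurable_floor_eq (mf v) (mf v')).
Qed.

(** Given the two projections, the independent offset makes them collide with probability [tent] of
    their difference. By stability this difference is distributed as the distance times a variable
    of law [D], so the expectation is [Phi]. *)
Lemma collision_prob v v' b : 0 < dist_s s v v' ->
  Pr (collision v v' b) = (Phi fD w (dist_s s v v'))%:E.
Proof.
case: b => [[t j] i] l0; rewrite (Phi_integral fDP w0 l0).
pose Y (u : 'rV[R]_(d + 1)) o := \sum_(l < d + 1) X (t, j, i, val l) o * u 0 l.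
pose b := X (t, j, i, (d + 1)%N).
have mY u : measurable_fun setT (Y u).
  by apply: measurable_sum => l; apply: measurable_funM.
pose E : set (R * R * R) :=
  [set x | Num.floor ((x.1.1 + x.2) / w) = Num.floor ((x.1.2 + x.2) / w)].
have mE : measurable E.
  apply: measurable_floor_eq; apply: measurable_funM => //;
    apply: measurable_funD => //; exact: measurableT_comp.
have indYb A B : measurable A -> measurable B ->
    Pr ((fun o => (Y v o, Y v' o)) @^-1` A `&` b @^-1` B) =
    (Pr ((fun o => (Y v o, Y v' o)) @^-1` A) * Pr (b @^-1` B))%E.
  move=> mA mB.
  (* Coordinates have last index at most [d] and the offset has [d + 1], so the two blocks are
     disjoint. *)
  pose S := [set x : nat * nat * nat * nat | x.1 = (t, j, i) /\ (x.2 <= d)%N].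
  pose S' := [set x : nat * nat * nat * nat | x = (t, j, i, (d + 1)%N)].
  apply: (@indep_sigma_cylinders _ _ _ _ _ _ mX indX S S').
  - by apply/disj_setPS => x [[_ /=] + xE]; rewrite xE/= addn1 ltnn.
  - have mYG u : measurable_fun setT
        (Y u : g_sigma_algebraType (cylinders X S) -> R).
      apply: measurable_sum => l; apply: measurable_funM => //.
      apply: measurable_cylinders; split => //=.
      by rewrite -ltnS -[X in (_ < X)%N]addn1 ltn_ord.
    have := measurable_fun_pair (mYG v) (mYG v').
    by move=> /(_ measurableT A mA); rewrite setTI.
  - have := @measurable_cylinders _ _ _ _ X S' (t, j, i, (d + 1)%N) erefl.
    by move=> /(_ measurableT B mB); rewrite setTI.
have -> : collision v v' (t, j, i) = [set o | E ((Y v o, Y v' o), b o)] by [].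
rewrite (independent_pair (measurable_fun_pair (mY v) (mY v')) (mX _) indYb mE).
transitivity (\int[Pr]_o (tent w (Y v o - Y v' o))%:E)%E.
  apply: eq_integral => o _; rewrite lawb; last exact: measurable_xsection.
  rewrite /unif_law (_ : lebesgue_measure _ = (w * tent w (Y v o - Y v' o))%:E).
    by rewrite -EFinM mulrAC divff ?mul1r ?gt_eqF.
  rewrite -(measure_floor_collision w0); congr (lebesgue_measure (_ `&` _)).
  apply/seteqP; split=> z zE; first exact: ((xsectionP _ _ E).1 zE).
  by apply/xsectionP; exact: zE.
apply: (@ge0_integral_same_law _ _ _ _ _ _ _ Pr D (fun o => Y v o - Y v' o)
  (fun x => dist_s s v v' * x) (fun x => (tent w x)%:E)).
- exact: measurable_funB.
- exact: mulrl_measurable.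
- move=> B mB.
  pose f (l : 'I_(d + 1)) := (t, j, i, val l).
  have fI : injective f by move=> l l' [/val_inj].
  have indY := mutually_independent_inj fI indX.
  have lawY l : has_law Pr ((X \o f) l) D.
    by apply: lawX; rewrite -ltnS -[X in (_ < X)%N]addn1 ltn_ord.
  (* Stability with coefficients [v - v'], whose [s]-norm is [dist_s s v v']. *)
  have e := @stD _ (fun l => v 0 l - v' 0 l) _ _ _ _ (fun l => mX (f l)) indY lawY
    B mB.
  rewrite (_ : (fun o => Y v o - Y v' o) =
    (fun o => \sum_(l < d + 1) (v 0 l - v' 0 l) * (X \o f) l o)); first exact: e.
  apply: funext => o.
  by rewrite /Y -sumrB; apply: eq_bigr => l _; rewrite /= mulrBl !(mulrC (X _ _)).
- by apply/measurable_EFinP; exact: measurable_tent.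
- by move=> y; rewrite lee_fin tent_ge0.
Qed.

End Collision.

(** * The function Phi *)

Section PhiProperties.
Context (R : realType) (D : probability R R) (fD : R -> R) (w : R).
Hypothesis fDP : abs_density D fD.
Hypothesis w0 : 0 < w.

Let measurable_tentZ (l : R) : measurable_fun setT (fun x => tent w (l * x)).
Proof.
by apply: measurableT_comp; [exact: measurable_tent|exact: mulrl_measurable].
Qed.

(** In the integral form the integrand decreases pointwise in [l]. *)
Lemma Phi_antitone (l l' : R) : 0 < l -> l <= l' -> Phi fD w l' <= Phi fD w l.
Proof.
move=> l0 ll'; have l'0 := lt_le_trans l0 ll'.
rewrite -lee_fin !(Phi_integral fDP)//; apply: ge0_le_integral => //.
- by move=> x _; rewrite lee_fin tent_ge0.
- by apply/measurable_EFinP.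
- by apply/measurable_EFinP.
move=> x _; rewrite lee_fin /tent.
apply: le_max2 => //; rewrite lerD2l lerN2 ler_pM2r ?invr_gt0// !normrM.
by rewrite ler_wpM2r// !gtr0_norm.
Qed.

Lemma abs_density_set0 : D [set 0] = 0%E.
Proof.
have [_ [_ fDE]] := fDP.
have <- : (fun x : R => `|x|) @^-1` [set 0] = [set 0].
  apply/seteqP; split=> x /=; first by move/eqP; rewrite normr_eq0 => /eqP.
  by move=> ->; rewrite normr0.
by rewrite fDE// integral_set1.
Qed.

(** If the value were 1, then [1 - tent w (l * x)] would vanish almost everywhere; it vanishes only
    at [x = 0], which is null because the absolute value has a density. *)
Lemma Phi_lt1 (l : R) : 0 < l -> Phi fD w l < 1.
Proof.
move=> l0; rewrite lt_neqAle; apply/andP; split; last first.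
  rewrite -lee_fin (Phi_integral fDP)//; exact: integral_tent_le1.
apply/eqP => P1.
have mg : measurable_fun setT (fun x => (1 - tent w (l * x))%:E).
  by apply/measurable_EFinP; apply: measurable_funB.
have g0 : (\int[D]_x `|(1 - tent w (l * x))%:E| = 0)%E.
  have : (\int[D]_x ((tent w (l * x))%:E + (1 - tent w (l * x))%:E) = 1)%E.
    rewrite -(@probability_setT _ _ _ D) -[RHS]mul1e -integral_cst//.
    by apply: eq_integral => x _; rewrite -EFinD addrC subrK.
  rewrite ge0_integralD//; last 3 first.
  - by move=> x _; rewrite lee_fin tent_ge0.
  - exact/measurable_EFinP.
  - by move=> x _; rewrite lee_fin subr_ge0 tent_le1.
  rewrite -(Phi_integral fDP)// P1 => e.
  under eq_integral do
    rewrite gee0_abs ?lee_fin ?subr_ge0 ?tent_le1//.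
  move: e; case: (integral _ _ _) => //= x [] /eqP.
  by rewrite -subr_eq0 addrAC subrr add0r => /eqP ->.
move: g0 => /(ae_eq_integral_abs D measurableT mg).
move=> [N [mN N0 sN]].
have : (D setT <= D N + D [set 0%R])%E.
  rewrite (le_trans _ (measureU2 _ _ _))//.
  apply: le_measure; rewrite ?inE//; first exact: measurableU.
  move=> x _; have [->|x0] := eqVneq x 0; [by right|left].
  apply: sN => e; have := EFin_inj (e I); move: e => _.
  have lx : 0 < `|l * x| / w by rewrite divr_gt0// normr_gt0 mulf_neq0// gt_eqF.
  by rewrite /tent maxEle; case: ifP => _; lra.
by rewrite N0 abs_density_set0 adde0 probability_setT lee_fin ler10.
Qed.

Section Positivity.
Context dO (Om : measurableType dO) (Pr : probability Om R) (s : R).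
Context (Y : 'I_2 -> Om -> R).
Hypothesis stD : s_stable s D.
Hypothesis mY : forall i, measurable_fun setT (Y i).
Hypothesis indY : mutually_independent Pr Y.
Hypothesis lawY : forall i, has_law Pr (Y i) D.

Lemma stable_mass_near0 (delta : R) : 0 < delta ->
  (0 < D [set x | (`|x| < delta)%R])%E.
Proof.
move=> d0.
(* The coefficients 1 and -1 form a difference of two copies, distributed as [kappa] times one
   copy. *)
pose alpha (i : 'I_2) : R := if i == ord0 then 1 else -1.
pose kappa := (\sum_(i < 2) `|alpha i| `^ s) `^ s^-1.
have k0 : 0 < kappa.
  rewrite /kappa powR_gt0// !big_ord_recl big_ord0 /alpha/= normrN !normr1.
  by rewrite !powR1 addr0 addr_gt0.
pose eta := kappa * delta.
have eta0 : 0 < eta by rewrite mulr_gt0.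
have mB (r : R) : measurable [set x : R | `|x| < r].
  have -> : [set x : R | `|x| < r] = `]- r, r[%classic.
    by apply/seteqP; split=> x /=; rewrite in_itv/= ltr_norml.
  by [].
pose A (z : int) := [set x : R | Num.floor (x / eta) = z].
have AE z : A z = [set` `[z%:~R * eta, (z + 1)%:~R * eta[].
  apply/seteqP; split=> x; rewrite /A /= in_itv/= -ler_pdivlMr// -ltr_pdivrMr//.
    by rewrite -floor_eq => ->.
  by rewrite -floor_eq => /eqP.
have mA z : measurable (A z) by rewrite AE.
(* Two independent copies of [X] falling in the same cell [A z] differ by less
   than [eta]; so if [X] had no mass near 0, each cell would be null. *)
have DA z : (D (A z) * D (A z) <= D [set x | (`|x| < delta)%R])%E.
  have e := @stD _ alpha _ _ _ _ mY indY lawY _ (mB eta).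
  have -> : D [set x | (`|x| < delta)%R] =
      Pr [set o | `|\sum_(i < 2) alpha i * Y i o| < eta].
    rewrite [RHS]e; congr (D _); apply/seteqP.
    by split=> x /=; rewrite normrM (gtr0_norm k0) ltr_pM2l.
  have := @indY (enum 'I_2) (fun=> A z) (enum_uniq _) (fun=> mA z).
  rewrite big_enum/= !big_ord_recl big_ord0 mule1 !lawY// => <-.
  apply: le_measure; rewrite ?inE.
  - apply: fin_bigcap_measurable => // i _.
    by rewrite -[_ @^-1` _]setTI; exact: mY.
  - rewrite -[mkset _]setTI.
    have /(_ measurableT _ (mB eta)) : measurable_fun setT
      (fun o => \sum_(i < 2) alpha i * Y i o).
      by apply: measurable_sum => i; exact: measurable_funM.
    by [].
  move=> o oA /=; have := oA ord0; have := oA (lift ord0 ord0).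
  rewrite /= !mem_enum AE /= !in_itv/=.
  move=> /(_ isT) /andP[h1 h2] /(_ isT) /andP[h3 h4].
  rewrite !big_ord_recl big_ord0 /alpha/= addr0 mul1r mulN1r ltr_norml.
  move: h2 h4; rewrite intrD mulrDl mul1r => h2 h4.
  by apply/andP; split; lra.
rewrite lt0e measure_ge0 andbT; apply/eqP => D0.
have DA0 z : D (A z) = 0%E.
  have := DA z; rewrite D0.
  have : (0 <= D (A z))%E by [].
  case: (D (A z)) => [x||] //.
  rewrite -EFinM !lee_fin => x0 xx; congr (_%:E); apply/eqP.
  by rewrite -sqrf_eq0 expr2 eq_le xx mulr_ge0.
(* Countably many null cells cover the line, contradicting total mass 1. *)
have : D setT = 0%E.
  apply: measure_negligible => //.
  rewrite (_ : setT = \bigcup_n (if unpickle n is Some z then A z else set0)).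
    apply: negligible_bigcup => n.
    case: unpickle => [z|]; last exact: negligible_set0.
    by apply/negligibleP => //; exact: DA0.
  apply/seteqP; split=> // x _.
  have [z xz] : exists z, z = Num.floor (x / eta) by exists (Num.floor (x / eta)).
  by exists (pickle z); [exact: I|rewrite pickleK xz].
by rewrite probability_setT => /eqP; rewrite onee_eq0.
Qed.

(** The tent exceeds [1 / 2] for [x] within [w / l / 2] of 0, and [D] charges that neighbourhood. *)
Lemma Phi_gt0 (l : R) : 0 < l -> 0 < Phi fD w l.
Proof.
move=> l0; rewrite -lte_fin (Phi_integral fDP)//.
pose delta := w / l / 2.
have d0 : 0 < delta by rewrite !divr_gt0.
pose B := [set x : R | `|x| < delta].
have mB : measurable B.
  rewrite (_ : B = `]- delta, delta[%classic)//.
  by apply/seteqP; split=> x /=; rewrite in_itv/= /B /= ltr_norml.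
apply: (@lt_le_trans _ _ (\int[D]_x (2^-1 * \1_B x)%:E)%E).
  under eq_integral do rewrite EFinM.
  rewrite ge0_integralZl_EFin//; last first.
    exact/measurable_EFinP/measurable_indic.
  rewrite integral_indic// setIT mule_gt0//; exact: stable_mass_near0.
apply: ge0_le_integral => //.
- by apply/measurable_EFinP/measurable_funM => //; exact: measurable_indic.
- by apply/measurable_EFinP.
move=> x _; rewrite lee_fin indicE; have [|_] := boolP (x \in B); last first.
  by rewrite mulr0 tent_ge0.
rewrite inE mulr1 /B /= /delta => xd; rewrite /tent le_max; apply/orP; right.
rewrite normrM (gtr0_norm l0).
have : l * `|x| / w < 2^-1.
  rewrite ltr_pdivrMr// -ltr_pdivlMl// (lt_le_trans xd)//.
  by rewrite (mulrC w) -mulrA (mulrC w).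
lra.
Qed.

End Positivity.
End PhiProperties.

(** * Geometry of the lift *)

Section LiftGeometry.
Context (R : realType) (s r eps : R).
Hypotheses (s0 : 0 < s) (r0 : 0 < r) (eps0 : 0 < eps).

Let powRVK (x : R) : 0 <= x -> (x `^ s^-1) `^ s = x.
Proof. by move=> x0; rewrite -powRrM mulVf ?gt_eqF// powRr1. Qed.

(** Distances are compared through their [s]-th powers, which are additive over coordinates. *)
Lemma ler_powR_iff (x y : R) : 0 <= x -> 0 <= y ->
  (x <= y) = (x `^ s <= y `^ s).
Proof.
move=> x0 y0; apply/idP/idP => [|H].
  by apply: ge0_ler_powR => //; exact: ltW.
rewrite leNgt; apply/negP => yx; move: H; apply/negP; rewrite -ltNge.
by apply: gt0_ltr_powR.
Qed.

Lemma dist_s_ge0 m (x y : 'rV[R]_m) : 0 <= dist_s s x y.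
Proof. exact: powR_ge0. Qed.

Lemma dist_s_powR m (x y : 'rV[R]_m) :
  dist_s s x y `^ s = \sum_(i < m) `|x 0 i - y 0 i| `^ s.
Proof. by rewrite powRVK// sumr_ge0// => i _; exact: powR_ge0. Qed.

Let u := (1 + eps) `^ s.

Let u1 : 1 < u.
Proof.
suff : 1 `^ s < u by rewrite powR1.
by apply: gt0_ltr_powR => //; rewrite ?nnegrE ?ler01 ?addr_ge0 ?ltrDl// ltW.
Qed.

Let rs0 : 0 < r `^ s. Proof. exact: powR_gt0. Qed.

(** Equivalently [r'^s = r^s + h^s] with [h] the height: [r'] is the unscaled lifted distance of a
    point at distance [r]. *)
Let r'E : r'_of s r eps `^ s = r `^ s * u / (u - 1).
Proof.
have u1' := u1.
rewrite /r'_of powRM ?powR_ge0// ?(ltW r0)// powRVK; last first.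
  by rewrite addr_ge0// invr_ge0 -/u; lra.
rewrite -/u -mulrA; congr (_ * _).
by field; apply/eqP; lra.
Qed.

Let hE : height_of s r eps `^ s = r `^ s / (u - 1).
Proof.
have u1' := u1.
rewrite /height_of powRM ?(ltW r0)// ?invr_ge0 ?powR_ge0// -powR_inv1 ?powR_ge0//.
by rewrite powRAC powRVK -/u ?powR_inv1//; lra.
Qed.

Let r'0 : 0 < r'_of s r eps.
Proof.
have u1' := u1.
by rewrite mulr_gt0// powR_gt0// addr_gt0// invr_gt0 -/u; lra.
Qed.

Let h0 : 0 < height_of s r eps.
Proof. have u1' := u1; by rewrite divr_gt0// powR_gt0// -/u; lra. Qed.

(** The extra coordinate adds [h^s] to the sum, and rescaling divides everything by [r'^s]. *)
Lemma dist_lift_powR d (p q : 'rV[R]_d) :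
  dist_s s (lift_pt 0 (r'_of s r eps) p)
           (lift_pt (height_of s r eps) (r'_of s r eps) q) `^ s =
  (dist_s s p q `^ s * (u - 1) / r `^ s + 1) / u.
Proof.
have u1' := u1.
rewrite !dist_s_powR /lift_pt big_split_ord/= big_ord1.
rewrite !mxE/= !(unsplitK (inr _)) !mxE -mulrBr sub0r normrM normrN.
under eq_bigr => i _.
  rewrite !mxE/= !(unsplitK (inl _)) -mulrBr normrM powRM//.
  over.
rewrite -mulr_sumr powRM// -mulrDr (gtr0_norm h0) gtr0_norm ?invr_gt0// hE.
rewrite -powR_inv1 ?(ltW r'0)// powRAC r'E powR_inv1; last first.
  by rewrite divr_ge0// ?mulr_ge0 ?powR_ge0//; lra.
by field; rewrite (gt_eqF rs0); apply/and3P; split=> //; apply/eqP; lra.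
Qed.

Lemma dist_lift_le1 d (p q : 'rV[R]_d) :
  (dist_s s (lift_pt 0 (r'_of s r eps) p)
     (lift_pt (height_of s r eps) (r'_of s r eps) q) <= 1) =
  (dist_s s p q <= r).
Proof.
have u1' := u1.
rewrite (ler_powR_iff (dist_s_ge0 _ _) ler01) powR1 dist_lift_powR.
rewrite (ler_powR_iff (dist_s_ge0 p q) (ltW r0)).
rewrite ler_pdivrMr ?mul1r; last lra.
rewrite -lerBrDr ler_pdivrMr// mulrC ler_pM2l//; lra.
Qed.

(** The lifted distance grows with the original one, and at [r * (1 + eps)] its [s]-th power is
    [(u * (u - 1) + 1) / u = u + u^-1 - 1]. *)
Lemma dist_lift_far d (p q : 'rV[R]_d) : r * (1 + eps) < dist_s s p q ->
  ((1 + eps) `^ s + (1 + eps) `^ (- s) - 1) `^ s^-1 <=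
  dist_s s (lift_pt 0 (r'_of s r eps) p)
     (lift_pt (height_of s r eps) (r'_of s r eps) q).
Proof.
have u1' := u1.
move=> far; rewrite (ler_powR_iff (powR_ge0 _ _) (dist_s_ge0 _ _)).
have Vu : 0 < u^-1 by rewrite invr_gt0; lra.
rewrite powRN -/u powRVK; last lra.
rewrite dist_lift_powR ler_pdivlMr; last lra.
have ru : r `^ s * u <= dist_s s p q `^ s.
  have e0 : 0 <= 1 + eps by rewrite addr_ge0// ltW.
  rewrite /u -powRM ?(ltW r0)// -ler_powR_iff ?dist_s_ge0//; first exact: ltW.
  by rewrite mulr_ge0// ltW.
apply: (@le_trans _ _ (r `^ s * u * (u - 1) / r `^ s + 1)).
  have -> : r `^ s * u * (u - 1) / r `^ s + 1 = (u + u^-1 - 1) * u; last by [].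
  by field; rewrite (gt_eqF rs0); apply/andP; split=> //; apply/eqP; lra.
by rewrite lerD2r ler_pM2r ?invr_gt0// ler_pM2r//; lra.
Qed.

(** The height alone contributes [1 / u], the [s]-th power of [1 / (1 + eps)]. This caps every
    collision probability by [p0] and keeps lifted distances positive. *)
Lemma dist_lift_ge d (p q : 'rV[R]_d) :
  (1 + eps)^-1 <= dist_s s (lift_pt 0 (r'_of s r eps) p)
     (lift_pt (height_of s r eps) (r'_of s r eps) q).
Proof.
have u1' := u1.
have e0 : 0 <= 1 + eps by rewrite addr_ge0// ltW.
have e1 : 0 <= (1 + eps)^-1 by rewrite invr_ge0.
rewrite (ler_powR_iff e1 (dist_s_ge0 _ _)) dist_lift_powR.
have -> : (1 + eps)^-1 `^ s = u^-1.
  by rewrite -(powR_inv1 e0) powRAC powR_inv1// powR_ge0.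
rewrite ler_pdivlMr; last lra.
rewrite mulVf ?lerDr ?gt_eqF//; last lra.
rewrite divr_ge0 ?mulr_ge0 ?powR_ge0//; lra.
Qed.

(** The excess of [u + u^-1] over 2 is [(u - 1)^2 / u]. This yields [p2 <= p1]. *)
Lemma far_dist_ge1 : 1 <= ((1 + eps) `^ s + (1 + eps) `^ (- s) - 1) `^ s^-1.
Proof.
have u1' := u1.
rewrite ler_powR_iff ?powR_ge0// powR1 powRVK powRN -/u.
  have -> : u + u^-1 - 1 = 1 + (u - 1) ^+ 2 / u.
    by field; apply/eqP; lra.
  by rewrite lerDl divr_ge0 ?sqr_ge0//; lra.
have : 0 < u^-1 by rewrite invr_gt0; lra.
lra.
Qed.

End LiftGeometry.

(** * Matches and queries *)

Lemma prod_EFin_cst (R : realType) (I : eqType) (J : seq I) (f : I -> \bar R)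
    (a : R) : (forall i, i \in J -> f i = a%:E) ->
  (\prod_(i <- J) f i)%E = (a ^+ size J)%:E.
Proof.
elim: J => [|i J ih] fE; first by rewrite big_nil expr0.
rewrite big_cons ih => [|j jJ]; last by rewrite fE// inE jJ orbT.
by rewrite fE ?mem_head// -EFinM exprS.
Qed.

Section HashTables.
Context (R : realType) (s : R) (D : probability R R) (fD : R -> R) (w : R).
Context dO (Om : measurableType dO) (Pr : probability Om R).
Context (X : nat * nat * nat * nat -> Om -> R) (d : nat).
Hypothesis w0 : 0 < w.
Hypothesis stD : s_stable s D.
Hypothesis fDP : abs_density D fD.
Hypothesis mX : forall i, measurable_fun setT (X i).
Hypothesis indX : mutually_independent Pr X.
Hypothesis lawX : forall t j i l, (l <= d)%N -> has_law Pr (X (t, j, i, l)) D.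
Hypothesis lawb : forall t j i,
  has_law Pr (X (t, j, i, (d + 1)%N)) (unif_law w).
Context (k : nat) (v v' : 'rV[R]_(d + 1)).
Hypothesis vv' : 0 < dist_s s v v'.

Definition key_match (tj : nat * nat) : set Om :=
  [set o | g_key X w k o tj.1 tj.2 v == g_key X w k o tj.1 tj.2 v'].

Lemma key_matchE tj : key_match tj =
  \bigcap_(b in [set` [seq (tj, i) | i <- iota 0 k]]) collision w X v v' b.
Proof.
apply/seteqP; split=> [x|x xC]; rewrite /key_match /=.
  move=> /eqP/eq_in_map e b /= /mapP[i ik ->]; exact: e.
apply/eqP/eq_in_map => i ik.
by have := xC (tj, i); apply; rewrite /= map_f.
Qed.

(** Coarser than [hash_block]: everything drawn for one table, so that distinct tables get disjoint
    blocks. *)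
Definition table_block (tj : nat * nat) : set (nat * nat * nat * nat) :=
  [set x | x.1.1 = tj].

Lemma key_match_sigma tj :
  <<s cylinders X (table_block tj) >> (key_match tj).
Proof.
rewrite key_matchE.
apply: (@fin_bigcap_measurable _ (g_sigma_algebraType _)) => //.
move=> b /= /mapP[i _ ->].
have sub : hash_block (tj, i) `<=` table_block tj.
  by move=> x xE; rewrite /table_block /= xE.
by apply: (sigma_cylindersS sub); exact: collision_sigma.
Qed.

Lemma measurable_key_match tj : measurable (key_match tj).
Proof. by apply: (sigma_cylinders_measurable mX); exact: key_match_sigma. Qed.

(** The [k] functions of a table use disjoint blocks, so their collision probabilities multiply. *)
Lemma key_match_prob tj : Pr (key_match tj) = (Phi fD w (dist_s s v v') ^+ k)%:E.
Proof.
rewrite key_matchE (block_independence mX indX (S := hash_block)).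
- rewrite (prod_EFin_cst (a := Phi fD w (dist_s s v v'))).
    by rewrite size_map size_iota.
  by move=> b _; exact: (collision_prob w0 stD fDP mX indX lawX lawb _ vv').
- by rewrite map_inj_uniq ?iota_uniq// => i j [].
- move=> b b' _ _ /eqP bb'; apply/disj_setPS => x [xb xb'].
  by apply: bb'; exact: etrans (esym xb) xb'.
- by move=> b _; exact: collision_sigma.
Qed.

(** The same argument one level up, with whole tables as blocks. *)
Lemma no_key_match_prob (J : seq (nat * nat)) : uniq J ->
  Pr (\bigcap_(tj in [set` J]) ~` key_match tj) =
  ((1 - Phi fD w (dist_s s v v') ^+ k) ^+ size J)%:E.
Proof.
move=> uJ; rewrite (block_independence mX indX (S := table_block))//.
- apply: prod_EFin_cst => tj _.
  rewrite probability_setC ?key_match_prob//; exact: measurable_key_match.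
- move=> b b' _ _ /eqP bb'; apply/disj_setPS => x [xb xb'].
  by apply: bb'; exact: etrans (esym xb) xb'.
- move=> tj _.
  apply: (@measurableC _ (g_sigma_algebraType _)); exact: key_match_sigma.
Qed.

End HashTables.

Lemma measure_bigsetU_le d (T : measurableType d) (R : realType)
    (mu : {measure set T -> \bar R}) (I : Type) (J : seq I) (F : I -> set T) :
  (forall i, measurable (F i)) ->
  (mu (\big[setU/set0]_(i <- J) F i) <= \sum_(i <- J) mu (F i))%E.
Proof.
move=> mF; elim: J => [|i J ih]; first by rewrite !big_nil measure0.
rewrite !big_cons (le_trans (measureU2 _ _ _))//; first exact: bigsetU_measurable.
exact: leeD2l.
Qed.

(** * Number of matching tables *)

Section Matches.
Context (R : realType) (s : R) (D : probability R R) (fD : R -> R) (w : R).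
Context dO (Om : measurableType dO) (Pr : probability Om R).
Context (X : nat * nat * nat * nat -> Om -> R) (d : nat).
Hypothesis w0 : 0 < w.
Hypothesis stD : s_stable s D.
Hypothesis fDP : abs_density D fD.
Hypothesis mX : forall i, measurable_fun setT (X i).
Hypothesis indX : mutually_independent Pr X.
Hypothesis lawX : forall t j i l, (l <= d)%N -> has_law Pr (X (t, j, i, l)) D.
Hypothesis lawb : forall t j i,
  has_law Pr (X (t, j, i, (d + 1)%N)) (unif_law w).
Context (k : nat).

Definition n_matches (J : seq (nat * nat)) (v v' : 'rV[R]_(d + 1)) (o : Om) :=
  (\sum_(tj <- J) (g_key X w k o tj.1 tj.2 v == g_key X w k o tj.1 tj.2 v'))%N.

Lemma n_matches_gt0 (J : seq (nat * nat)) v v' o :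
  (0 < n_matches J v v' o)%N <->
  ~ (\bigcap_(tj in [set` J]) ~` key_match w X k v v' tj) o.
Proof.
rewrite lt0n sum_nat_seq_neq0; split=> [/hasP[tj tjJ /=]|H].
  by rewrite eqb0 negbK => m /(_ tj tjJ); apply.
apply: contrapT => /negP/hasPn noJ; apply: H => tj /= tjJ m.
by have := noJ tj tjJ; rewrite eqb0 negbK => /negP; apply.
Qed.

Lemma n_matchesE (J : seq (nat * nat)) v v' o : (n_matches J v v' o)%:R%:E =
  (\sum_(tj <- J) (\1_(key_match w X k v v' tj) o)%:E)%E :> \bar R.
Proof.
rewrite /n_matches natr_sum -sumEFin; apply: eq_bigr => tj _.
rewrite indicE; congr (_%:R%:E); congr nat_of_bool.
by apply/idP/idP; rewrite inE.
Qed.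

Lemma measurable_n_matches (J : seq (nat * nat)) v v' :
  measurable_fun setT (fun o => (n_matches J v v' o)%:R%:E : \bar R).
Proof.
under eq_fun do rewrite n_matchesE.
apply: emeasurable_sum => tj; apply/measurable_EFinP/measurable_indic.
exact: measurable_key_match.
Qed.

Lemma expected_matches (J : seq (nat * nat)) v v' : 0 < dist_s s v v' ->
  (\int[Pr]_o (n_matches J v v' o)%:R%:E =
   ((size J)%:R * Phi fD w (dist_s s v v') ^+ k)%:E)%E.
Proof.
move=> vv'; have mm tj := measurable_key_match w mX k v v' tj.
under eq_integral do rewrite n_matchesE.
rewrite ge0_integral_sum//; last first.
  by move=> tj; apply/measurable_EFinP/measurable_indic.
transitivity (\sum_(tj <- J) (Phi fD w (dist_s s v v') ^+ k)%:E)%E.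
  apply: eq_bigr => tj _; rewrite integral_indic// setIT.
  exact: (key_match_prob w0 stD fDP mX indX lawX lawb).
by rewrite sumEFin big_const_seq count_predT iter_addr_0 mulr_natl.
Qed.

End Matches.

(** * Expected cost and correctness of a query *)

Section Query.
Context (R : realType) (s : R) (D : probability R R) (fD : R -> R) (w c : R).
Context dO (Om : measurableType dO) (Pr : probability Om R).
Context (X : nat * nat * nat * nat -> Om -> R) (d : nat).
Context (P : seq 'rV[R]_d) (r eps : R) (q : 'rV[R]_d).
Hypothesis w0 : 0 < w.
Hypothesis stD : s_stable s D.
Hypothesis fDP : abs_density D fD.
Hypothesis mX : forall i, measurable_fun setT (X i).
Hypothesis indX : mutually_independent Pr X.
Hypothesis lawX : forall t j i l, (l <= d)%N -> has_law Pr (X (t, j, i, l)) D.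
Hypothesis lawb : forall t j i,
  has_law Pr (X (t, j, i, (d + 1)%N)) (unif_law w).
Hypotheses (s0 : 0 < s) (r0 : 0 < r) (eps0 : 0 < eps) (qP : q \notin P).

Let N := size P.
Let kk := k_of fD w (eps'_of s eps) N.
Let LL := L_of fD w (eps'_of s eps) N.
Let TT := rounds_of c N.
Let lp (p : 'rV[R]_d) := lift_pt 0 (r'_of s r eps) p.
Let lq := lift_pt (height_of s r eps) (r'_of s r eps) q.

Let tables := [seq (t, j) | t <- iota 0 TT, j <- iota 0 LL].

Let size_tables : size tables = (TT * LL)%N.
Proof. by rewrite size_allpairs !size_iota. Qed.

Let n_hitsE o p : n_hits s fD w c X P r eps q o p =
  n_matches w X kk tables (lp p) lq o.
Proof.
rewrite /n_matches big_allpairs -!val_enum_ord big_map big_enum.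
by apply: eq_bigr => t _; rewrite big_map big_enum.
Qed.

Let lift_dist p := dist_s s (lp p) lq.

Let lift_dist_gt0 p : 0 < lift_dist p.
Proof.
by rewrite (lt_le_trans _ (dist_lift_ge s0 r0 eps0 p q))// invr_gt0 addr_gt0.
Qed.

Lemma expected_query_time :
  (\int[Pr]_o ((query_time s fD w c X P r eps q o)%:R)%:E =
   ((TT * LL * kk)%:R +
    \sum_(p <- P) (TT * LL)%:R * Phi fD w (lift_dist p) ^+ kk)%:E)%E.
Proof.
have mh p : measurable_fun setT
    (fun o => (n_hits s fD w c X P r eps q o p)%:R%:E : \bar R).
  under eq_fun do rewrite n_hitsE; exact: measurable_n_matches.
under eq_integral do rewrite /query_time natrD EFinD natr_sum -sumEFin.
rewrite ge0_integralD//; last 2 first.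
- by move=> o _; apply: sume_ge0 => p _; rewrite lee_fin.
- exact: emeasurable_sum.
rewrite integral_cst// [X in (_ * X)%E](_ : _ = 1%E); last first.
  exact: probability_setT.
rewrite mule1 ge0_integral_sum//.
rewrite EFinD -sumEFin; congr (_ + _)%E; apply: eq_bigr => p _.
under eq_integral do rewrite n_hitsE.
rewrite (expected_matches w0 stD fDP mX indX lawX lawb) ?size_tables//.
exact: lift_dist_gt0.
Qed.

(** The distance filter excludes false positives, since lifted distance at most 1 means distance at
    most [r]. The only failure is a neighbour missed by every table, estimated by a union bound. *)
Lemma query_correct_prob :
  (Pr [set o | query_output s fD w c X P r eps q o =i nbhd s P q r] >=
   (1 - \sum_(p <- nbhd s P q r)
          (1 - Phi fD w (lift_dist p) ^+ kk) ^+ (TT * LL))%:E)%E.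
Proof.
pose miss p := \bigcap_(tj in [set` tables]) ~` key_match w X kk (lp p) lq tj.
pose B := \big[setU/set0]_(p <- nbhd s P q r) miss p.
have mmiss p : measurable (miss p).
  apply: fin_bigcap_measurable => // tj _; apply: measurableC.
  exact: measurable_key_match.
have mB : measurable B by exact: bigsetU_measurable.
have -> : [set o | query_output s fD w c X P r eps q o =i nbhd s P q r] = ~` B.
  (* As [q] is not in [P], the clause [p != q] is automatic. *)
  have in_nbhd p : (p \in nbhd s P q r) = (p \in P) && (dist_s s p q <= r).
    rewrite mem_filter andbC; have [pP|//] := boolP (p \in P).
    by rewrite (memPn qP).
  apply/seteqP; split=> x /=.
    move=> e; rewrite /B -bigcup_seq => -[p /= pN].
    have := pN; rewrite -e mem_filter n_hitsE => /andP[/andP[+ _] _].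
    by move=> /n_matches_gt0.
  move=> nB p; rewrite in_nbhd mem_filter dist_lift_le1// n_hitsE.
  have [pP|] := boolP (p \in P); last by rewrite !andbF.
  have [pr|] := boolP (dist_s s p q <= r); last by rewrite andbF.
  rewrite !andbT; apply/n_matches_gt0 => xp; apply: nB.
  rewrite /B -bigcup_seq; exists p => //=.
  by rewrite in_nbhd pP.
rewrite probability_setC// EFinB leeD2l// leeN2.
rewrite -sumEFin (le_trans (measure_bigsetU_le _ _ _))//.
apply: lee_sum => p _.
have uT : uniq tables.
  by apply: allpairs_uniq; rewrite ?iota_uniq// => -[? ?] [? ?].
rewrite -size_tables.
by rewrite -(no_key_match_prob w0 stD fDP mX indX lawX lawb kk (lift_dist_gt0 p) uT).
Qed.

End Query.

(** * Parameter estimates *)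

Section RealBounds.
Context (R : realType).

Lemma natceil_ge (x : R) : x <= (natceil x)%:R.
Proof.
rewrite /natceil natr_absz (le_trans (ceil_ge x))// ler_int ler_norm//.
Qed.

Lemma natceil_le (x : R) : 0 <= x -> (natceil x)%:R <= x + 1.
Proof.
move=> x0; rewrite /natceil natr_absz ger0_norm ?ceil_ge0//; last first.
  by rewrite (lt_le_trans _ x0)// ltrN10.
have := ceil_itv x => /andP[+ _]; rewrite intrB; lra.
Qed.

Lemma natceil0 : natceil (0 : R) = 0%N.
Proof. by rewrite /natceil ceil0. Qed.

(** [(1 + 1/8)^8] exceeds [5 / 2], and [ln (1 + 1/8) <= 1/8]. *)
Lemma ln_5half : ln (5 / 2 : R) <= 1.
Proof.
have h : (5 / 2 : R) <= (1 + 8^-1) ^+ 8 by lra.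
have h8 : ln (1 + 8^-1 : R) <= 8^-1 by apply: le_ln1Dx; lra.
apply: (@le_trans _ _ (ln ((1 + 8^-1 : R) ^+ 8))).
  by rewrite ler_ln ?posrE// ?exprn_gt0//; lra.
rewrite lnXn; last lra.
by rewrite -[leLHS]mulr_natl; lra.
Qed.

Lemma exprE_ln (a : R) (m : nat) : 0 < a -> a ^+ m = expR (m%:R * ln a).
Proof. by move=> a0; rewrite expRM_natl lnK. Qed.

Lemma powRE_ln (a x : R) : 0 < a -> a `^ x = expR (x * ln a).
Proof. by move=> a0; rewrite /powR gt_eqF. Qed.

Context (p0 p1 p2 c : R) (n : nat).
Hypotheses (p20 : 0 < p2) (p21 : p2 <= p1) (p10 : p1 <= p0) (p01 : p0 < 1).
Hypotheses (n1 : (1 < n)%N) (c0 : 0 < c).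

Let p1_gt0 : 0 < p1 := lt_le_trans p20 p21.
Let p0_gt0 : 0 < p0 := lt_le_trans p1_gt0 p10.
Let p1_lt1 : p1 < 1 := le_lt_trans p10 p01.
Let p2_lt1 : p2 < 1 := le_lt_trans p21 p1_lt1.
Let ln0 : ln p0 < 0. Proof. by rewrite ln_lt0// p0_gt0. Qed.
Let ln1 : ln p1 < 0. Proof. by rewrite ln_lt0// p1_gt0. Qed.
Let ln2 : ln p2 < 0. Proof. by rewrite ln_lt0// p20. Qed.
Let ln21 : ln p2 <= ln p1. Proof. by rewrite ler_ln. Qed.
Let ln10 : ln p1 <= ln p0. Proof. by rewrite ler_ln. Qed.
Let nR0 : 0 < n%:R :> R. Proof. by rewrite ltr0n ltnW. Qed.
Let nR1 : 1 < n%:R :> R. Proof. by rewrite ltr1n. Qed.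
Let lnn : 0 < ln (n%:R : R). Proof. by rewrite ln_gt0. Qed.

Let rho := ln p1 / ln p2.
Let alpha := rho * (1 - ln p0 / ln p1).
(** [k] is the ceiling of [g * ln n]; in terms of [g] all exponents become linear in [ln p0],
    [ln p1] and [ln p2]. *)
Let g := (ln p2^-1)^-1.
Let k := natceil (ln (n%:R : R) / ln p2^-1).
Let L := natceil (n%:R `^ rho / p1).
Let T := natceil (c * ln (n%:R : R)).

Let gE : g = - (ln p2)^-1. Proof. by rewrite /g lnV// invrN. Qed.
Let g0 : 0 < g. Proof. by rewrite gE oppr_gt0 invr_lt0. Qed.
Let gln2 : g * ln p2 = -1. Proof. by rewrite gE mulNr mulVf// lt_eqF. Qed.
Let rhoE : rho = - g * ln p1. Proof. by rewrite gE opprK mulrC. Qed.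

Let k_ge : ln n%:R * g <= k%:R. Proof. exact: natceil_ge. Qed.
Let k_le : k%:R <= ln n%:R * g + 1.
Proof. by apply: natceil_le; rewrite mulr_ge0 ?ltW. Qed.

(** From [k >= g * ln n] and [g * ln p2 = -1]. All far points together thus cost at most one
    expected retrieval per table. *)
Lemma far_match_le : n%:R * p2 ^+ k <= 1.
Proof.
rewrite exprE_ln// -[X in X * _]lnK// -expRD expR_le1.
have : k%:R * ln p2 <= ln n%:R * g * ln p2 by rewrite ler_nM2r.
by rewrite -mulrA gln2; lra.
Qed.

(** Rounding up adds at most one hash function, hence costs at most one factor [p1]. *)
Lemma near_match_ge : p1 * n%:R `^ (- rho) <= p1 ^+ k.
Proof.
rewrite exprE_ln// powRE_ln// -[X in X * _]lnK// -expRD ler_expR.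
have : (ln n%:R * g + 1) * ln p1 <= k%:R * ln p1 by rewrite ler_nM2r.
by rewrite rhoE; lra.
Qed.

(** [alpha] equals [rho + g * ln p0], the exponent that [k >= g * ln n] produces. *)
Lemma all_match_le : n%:R `^ rho * p0 ^+ k <= n%:R `^ alpha.
Proof.
rewrite exprE_ln// !powRE_ln// -expRD ler_expR.
have : k%:R * ln p0 <= ln n%:R * g * ln p0 by rewrite ler_nM2r.
have -> : alpha = rho + g * ln p0.
  rewrite /alpha /rho gE; field.
  by rewrite !lt_eqF.
lra.
Qed.

Lemma alpha_le : alpha <= rho.
Proof.
have -> : alpha = rho + g * ln p0.
  rewrite /alpha /rho gE; field.
  by rewrite !lt_eqF.
by rewrite gerDl nmulr_lle0// ltW.
Qed.

Let A := n%:R `^ rho / p1.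

(** This makes rounding up to [L] cost at most a factor 2. *)
Let A_ge1 : 1 <= A.
Proof.
have rho0 : 0 <= rho.
  by rewrite rhoE mulNr -mulrN; apply: mulr_ge0; rewrite ?oppr_ge0 ltW.
rewrite ler_pdivlMr// mul1r; apply: le_trans (ltW p1_lt1) _.
by rewrite powRE_ln// -[leLHS]expR0 ler_expR mulr_ge0// ltW.
Qed.

Lemma L_le : L%:R <= 2 * A.
Proof.
by rewrite (le_trans (natceil_le _))// -/A; have := A_ge1; lra.
Qed.

Lemma T_le (B : R) : 1 <= B -> ln n%:R <= B -> T%:R <= (c + 1) * B.
Proof.
move=> B1 lnB; apply: le_trans (natceil_le _) _; first by rewrite mulr_ge0// ltW.
have : c * ln n%:R <= c * B by rewrite ler_pM2l.
lra.
Qed.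

(** By [1 - x <= exp(-x)] the left side is at most [exp(-T * L * p1^k)]. Since [L >= A] and
    [p1^k >= p1 * n^(-rho) = 1 / A], each round contributes a factor at most [1 / e], and
    [T >= c * ln n]. *)
Lemma miss_le (p : R) : p1 <= p <= 1 ->
  (1 - p ^+ k) ^+ (T * L) <= n%:R `^ (- c).
Proof.
move=> /andP[pp p_le1].
have p_gt0 : 0 < p := lt_le_trans p1_gt0 pp.
have pk : p ^+ k <= 1 by rewrite exprn_ile1// ltW.
apply: (@le_trans _ _ (expR (- p1 ^+ k) ^+ (T * L))).
  rewrite lerXn2r ?nnegrE ?subr_ge0 ?expR_ge0//.
  apply: le_trans (expR_ge1Dx _); rewrite lerD2l lerN2 lerXn2r// nnegrE ltW//.
rewrite -expRM_natl powRE_ln// ler_expR mulrN mulNr lerN2 natrM.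
apply: (@le_trans _ _ T%:R); first exact: natceil_ge.
rewrite -mulrA ler_peMr//.
apply: (@le_trans _ _ (A * (p1 * n%:R `^ (- rho)))).
  rewrite /A powRN mulrA divfK ?gt_eqF// divff// gt_eqF// powR_gt0//.
apply: ler_pM near_match_ge; last exact: natceil_ge.
- by rewrite (le_trans ler01).
- by rewrite mulr_ge0 ?powR_ge0 ?ltW.
Qed.

(** The left side is [n^(1 - c)], and [ln (5 / 2) <= 1] weakens the exponent. *)
Lemma fail_le : n%:R * n%:R `^ (- c) <= n%:R `^ (1 - c * ln (5 / 2)).
Proof.
rewrite !powRE_ln// -[X in X * _]lnK// -expRD ler_expR.
have -> : ln n%:R + - c * ln n%:R = (1 - c) * ln n%:R by ring.
rewrite ler_pM2r// lerD2l lerN2.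
by rewrite ler_piMr ?ln_5half// ltW.
Qed.

Context (B : R).
Hypotheses (B1 : 1 <= B) (lnB : ln n%:R <= B).

Let cB0 : 0 <= (c + 1) * B.
Proof. by apply: mulr_ge0; have := B1; have := c0; lra. Qed.
Let A0 : 0 <= A. Proof. exact: le_trans ler01 A_ge1. Qed.

Lemma space_bound :
  (T * L * n)%:R <= 4 * (c + 1) * B ^+ 2 * (n%:R `^ (1 + rho) / p1).
Proof.
have -> : n%:R `^ (1 + rho) / p1 = A * n%:R.
  rewrite powRD; last by rewrite (gt_eqF nR0) implybT.
  by rewrite powRr1 ?(ltW nR0)// /A; ring.
rewrite !natrM mulrA ler_pM2r//.
have tl : T%:R * L%:R <= (c + 1) * B * (2 * A) by rewrite ler_pM ?T_le ?L_le.
apply: le_trans tl _.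
(* The slack factor [2 * B >= 1] lets space and time share one constant and one power of [B]. *)
have -> : 4 * (c + 1) * B ^+ 2 * A = (c + 1) * B * (2 * A) * (2 * B) by ring.
rewrite ler_peMr//; last by have := B1; lra.
by apply: mulr_ge0 => //; apply: mulr_ge0.
Qed.

(** Per table: [k] hash evaluations, an allowance of 1 for far retrievals, and [m * p0^k] for near
    ones. The first two are merged into [k + 1]. *)
Lemma time_bound (m : nat) :
  (T * L * k)%:R + (T * L)%:R * (1 + m%:R * p0 ^+ k) <=
  4 * (c + 1) * B ^+ 2 * (A * (g + 1) + n%:R `^ alpha / p1 * m%:R).
Proof.
have tl : T%:R * L%:R <= (c + 1) * B * (2 * A) by rewrite ler_pM ?T_le ?L_le.
(* One factor [B] absorbs the [ln n] in [k]; the other comes from [T]. *)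
have k1 : k%:R + 1 <= 2 * B * (g + 1).
  have : ln n%:R * g <= B * g by rewrite ler_pM2r.
  have : 0 < B * g by rewrite mulr_gt0// (lt_le_trans ltr01 B1).
  by have := k_le; have := B1; lra.
have m0 : A * p0 ^+ k <= n%:R `^ alpha / p1.
  by rewrite /A mulrAC ler_pM2r ?invr_gt0// all_match_le.
have Bm0 : 0 <= 2 * ((c + 1) * B) * m%:R.
  by apply: mulr_ge0 => //; exact: mulr_ge0.
have pk0 : 0 <= p0 ^+ k by rewrite exprn_ge0// ltW.
have na0 : 0 <= n%:R `^ alpha / p1 by rewrite divr_ge0 ?powR_ge0// ltW.
have TL0 : 0 <= T%:R * L%:R :> R by [].
have k0 : 0 <= k%:R + 1 :> R by [].
rewrite natrM natrM -mulrDr addrA mulrDr.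
move: (p0 ^+ k) pk0 (n%:R `^ alpha / p1) na0 m0 (T%:R * L%:R) TL0 tl.
move: (k%:R + 1) k0 k1 => k' k0 k1 x x0 y y0 m0 t t0 tl.
rewrite [leRHS]mulrDr; apply: lerD.
  have -> : 4 * (c + 1) * B ^+ 2 * (A * (g + 1)) =
     (c + 1) * B * (2 * A) * (2 * B * (g + 1)) by ring.
  exact: ler_pM.
apply: (@le_trans _ _ ((c + 1) * B * (2 * A) * (m%:R * x))).
  by rewrite ler_wpM2r// mulr_ge0.
have -> : (c + 1) * B * (2 * A) * (m%:R * x) =
  2 * ((c + 1) * B) * m%:R * (A * x) by ring.
have -> : 4 * (c + 1) * B ^+ 2 * (y * m%:R) =
  2 * ((c + 1) * B) * m%:R * y * (2 * B) by ring.
apply: (@le_trans _ _ (2 * ((c + 1) * B) * m%:R * y)).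
  exact: ler_wpM2l.
rewrite ler_peMr//; last by have := B1; lra.
exact: mulr_ge0.
Qed.

End RealBounds.

(** * Assembly of the bounds *)

Lemma sum_le_size (R : realType) (I : eqType) (J : seq I) (F : I -> R) (a : R) :
  (forall i, i \in J -> F i <= a) -> \sum_(i <- J) F i <= (size J)%:R * a.
Proof.
move=> Fa; rewrite big_seq (le_trans (ler_sum _ Fa))// -big_seq.
by rewrite big_const_seq count_predT iter_addr_0 mulr_natl.
Qed.

Unset Implicit Arguments.

Theorem theorem4 (R : realType) (c : R) : 0 < c ->
  exists (C : R) (K : nat), 0 < C /\
  forall (s : R) (D : probability R R) (fD : R -> R) (w : R)
    (dO : measure_display) (Om : measurableType dO) (Pr : probability Om R)
    (X : nat * nat * nat * nat -> Om -> R)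
    (d : nat) (P : seq 'rV[R]_d) (r eps : R) (q : 'rV[R]_d),
  0 < s <= 2 -> s_stable s D -> abs_density D fD -> 0 < w ->
  (forall i, measurable_fun setT (X i)) ->
  mutually_independent Pr X ->
  (forall t j i l, (l <= d)%N -> has_law Pr (X (t, j, i, l)) D) ->
  (forall t j i, has_law Pr (X (t, j, i, (d + 1)%N)) (unif_law w)) ->
  uniq P -> 0 < r -> 0 < eps -> q \notin P ->
  let n := size P in
  let p0 := Phi fD w (1 + eps)^-1 in
  let p1 := Phi fD w 1 in
  let p2 := Phi fD w (((1 + eps) `^ s + (1 + eps) `^ (- s) - 1) `^ s^-1) in
  let rho := ln p1 / ln p2 in
  let alpha := rho * (1 - ln p0 / ln p1) in
  let polylog := (1 + ln (1 + n%:R) + ln (1 + eps^-1)) ^+ K in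
  [/\ (Pr [set o | query_output s fD w c X P r eps q o =i nbhd s P q r]
         >= (1 - n%:R `^ (1 - c * ln (5 / 2)))%:E)%E,
      (\int[Pr]_o ((query_time s fD w c X P r eps q o)%:R)%:E
         <= (C * polylog *
             (n%:R `^ rho / p1 * ((ln p2^-1)^-1 + 1)
              + n%:R `^ alpha / p1 * (size (nbhd s P q (r * (1 + eps))))%:R))%:E)%E,
      (ds_space s fD w c P eps)%:R <= C * polylog * (n%:R `^ (1 + rho) / p1)
    & alpha <= rho].
Proof.
(* The product of [T <= (c + 1) * B], [L <= 2 * A] and [k + 1 <= 2 * B * (g + 1)] gives the constant
   and the power 2. *)
move=> c0; exists (4 * (c + 1)), 2%N; split; first by rewrite mulr_gt0// addr_gt0.
move=> s D fD w dO Om Pr X d P r eps q /andP[s0 _] stD fDP w0 mX indX lawX lawb.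
move=> _ r0 eps0 qP.
have epsV0 : 0 <= eps^-1 by rewrite invr_ge0 ltW.
have eps1 : 0 < 1 + eps by exact: addr_gt0.
have l0_gt0 : 0 < (1 + eps)^-1 by rewrite invr_gt0.
have l0_le1 : (1 + eps)^-1 <= 1 by rewrite invf_le1// lerDl ltW.
move=> n p0 p1 p2 rho alpha polylog.
have [l2 l2E] : {l2 | l2 = ((1 + eps) `^ s + (1 + eps) `^ (- s) - 1) `^ s^-1}.
  by exists (((1 + eps) `^ s + (1 + eps) `^ (- s) - 1) `^ s^-1).
have l2_ge1 : 1 <= l2 by rewrite l2E; exact: far_dist_ge1.
have l2_gt0 : 0 < l2 := lt_le_trans ltr01 l2_ge1.
have epsE : 1 + eps'_of s eps = l2 by rewrite /eps'_of -l2E addrC subrK.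
have nE : size P = n by [].
have p0E : Phi fD w (1 + eps)^-1 = p0 by [].
have p1E : Phi fD w 1 = p1 by [].
have p2E : Phi fD w l2 = p2 by rewrite l2E.
have kE : k_of fD w (eps'_of s eps) n = natceil (ln n%:R / ln p2^-1).
  by rewrite /k_of /pi2 epsE p2E.
have LE : L_of fD w (eps'_of s eps) n = natceil (n%:R `^ rho / p1).
  by rewrite /L_of /pi2 epsE p2E.
(* Positivity of [Phi] requires two independent copies of [D]: coordinate 0 of the first function in
   rounds 0 and 1, a legitimate index for every [d]. *)
pose f (i : 'I_2) := (val i, 0%N, 0%N, 0%N).
have fI : injective f by move=> i j [/val_inj].
have lawY i : has_law Pr ((X \o f) i) D by apply: lawX.
have Phi0 l : 0 < l -> 0 < Phi fD w l.
  exact: (Phi_gt0 fDP w0 stD (fun i => mX (f i))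
    (mutually_independent_inj fI indX) lawY).
have p20 : 0 < p2 by rewrite -p2E; exact: Phi0.
have p21 : p2 <= p1 by rewrite -p2E; exact: (Phi_antitone fDP).
have p10 : p1 <= p0 by rewrite -p0E; exact: (Phi_antitone fDP).
have p01 : p0 < 1 by rewrite -p0E; exact: (Phi_lt1 fDP).
clearbody n p0 p1 p2.
have p1_gt0 : 0 < p1 := lt_le_trans p20 p21.
have p2_le1 : p2 <= 1 := ltW (le_lt_trans p21 (le_lt_trans p10 p01)).
have lneps0 : 0 <= ln (1 + eps^-1) by rewrite ln_ge0// lerDl.
have lnn0 : 0 <= ln (1 + n%:R : R) by rewrite ln_ge0// lerDl.
have [B BE] : {B | B = 1 + ln (1 + n%:R : R) + ln (1 + eps^-1)}.
  by exists (1 + ln (1 + n%:R : R) + ln (1 + eps^-1)).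
have polylogE : polylog = B ^+ 2 by rewrite BE.
clearbody polylog; rewrite {polylog}polylogE.
have B1 : 1 <= B by rewrite BE -addrA lerDl; exact: addr_ge0.
have B0 : 0 <= B := le_trans ler01 B1.
have g0 : 0 <= (ln p2^-1)^-1 by rewrite invr_ge0 ln_ge0// invf_ge1.
have C0 : 0 <= 4 * (c + 1) * B ^+ 2.
  by rewrite mulr_ge0 ?exprn_ge0// mulr_ge0// addr_ge0// ltW.
have alpha_rho : alpha <= rho by exact: alpha_le.
have np1 x : 0 <= n%:R `^ x / p1 by rewrite divr_ge0 ?powR_ge0// ltW.
(* For [n <= 1] there are no rounds, as [ln 1 = 0] and [ln 0 = 0] by convention, so time and space
   vanish. The probability bound is 0 for [n = 1]; for [n = 0] both answer lists are empty. *)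
have [n1|n1] := leqP n 1.
  have T0 : rounds_of c n = 0%N.
    rewrite /rounds_of; move: n1; rewrite leq_eqVlt ltnS leqn0.
    by move=> /orP[/eqP->|/eqP->]; rewrite ?ln1 ?ln0// mulr0 natceil0.
  split=> //.
  - move: n1; rewrite leq_eqVlt ltnS leqn0 => /orP[/eqP->|/eqP n0].
      by rewrite powR1 subrr measure_ge0.
    rewrite (_ : mkset _ = setT).
      by rewrite probability_setT lee_fin gerBl powR_ge0.
    apply/seteqP; split=> // o _ x; rewrite /query_output /nbhd.
    by rewrite (size0nil (etrans nE n0)).
  - rewrite (eq_integral (fun=> 0%E)).
      rewrite integral0 lee_fin mulr_ge0// addr_ge0// mulr_ge0//.
      by rewrite addr_ge0.
    move=> o _; rewrite /query_time /n_hits nE T0 !mul0n add0n big1// => p _.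
    by rewrite big_ord0.
  - by rewrite /ds_space nE T0 !mul0n mulr_ge0.
have nR0 : 0 < n%:R :> R by rewrite ltr0n ltnW.
have lnB : ln n%:R <= B.
  apply: (@le_trans _ _ (ln (1 + n%:R))).
    by rewrite ler_ln ?posrE ?addr_gt0// lerDr.
  by rewrite BE; lra.
pose dl p := dist_s s (lift_pt 0 (r'_of s r eps) p)
  (lift_pt (height_of s r eps) (r'_of s r eps) q).
have dl_ge p : (1 + eps)^-1 <= dl p := dist_lift_ge s0 r0 eps0 p q.
have dl_gt0 p : 0 < dl p := lt_le_trans l0_gt0 (dl_ge p).
split=> //.
- apply: le_trans (query_correct_prob c w0 stD fDP mX indX lawX lawb s0 r0 eps0 qP).
  rewrite lee_fin lerD2l lerN2 nE kE LE.
  apply: le_trans (fail_le n1 c0).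
  (* At most [n] neighbours, each missed with probability at most [n^(-c)]. *)
  apply: (@le_trans _ _ ((size (nbhd s P q r))%:R * n%:R `^ (- c))); last first.
    by rewrite ler_wpM2r ?powR_ge0// ler_nat -nE size_filter count_size.
  apply: sum_le_size => p; rewrite mem_filter => /andP[/andP[_ pr] _].
  apply: (miss_le c p20 p21 p10 p01 n1); apply/andP; split.
    rewrite -p1E; apply: (Phi_antitone fDP) => //; first exact: dl_gt0.
    by rewrite dist_lift_le1.
  by apply: ltW; apply: (Phi_lt1 fDP) => //; exact: dl_gt0.
- rewrite (expected_query_time c P q w0 stD fDP mX indX lawX lawb s0 r0 eps0).
  rewrite lee_fin nE kE LE -mulr_sumr.
  set k := natceil (ln n%:R / _).
  set m := size (nbhd s P q _).
  apply: le_trans (time_bound p20 p21 p10 p01 n1 c0 B1 lnB m).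
  rewrite lerD2l ler_wpM2l//.
  (* The [m] near points are charged [p0^k] each; the far ones are charged [p2^k] each, hence at
     most 1 in total. *)
  pose near p := (p != q) && (dist_s s p q <= r * (1 + eps)).
  rewrite (bigID near)/= addrC -[X in X + _ <= _]big_filter.
  rewrite -[X in _ + X <= _]big_filter; apply: lerD.
    apply: (@le_trans _ _ (n%:R * p2 ^+ k)); last first.
      exact: (far_match_le p20 p21 p10 p01 n1).
    apply: (@le_trans _ _ ((size [seq p <- P | ~~ near p])%:R * p2 ^+ k)).
      apply: sum_le_size => p; rewrite mem_filter => /andP[pfar pP].
      apply: lerXn2r; rewrite ?nnegrE; [exact: ltW (Phi0 _ (dl_gt0 p))|exact: ltW|].
      rewrite -p2E; apply: (Phi_antitone fDP) => //.
      rewrite l2E; apply: dist_lift_far => //.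
      (* A point that is not near is either [q], excluded by [q \notin P], or farther than
         [r * (1 + eps)]. *)
      move: pfar; rewrite /near negb_and negbK -ltNge => /orP[/eqP pq|//].
      by move: qP; rewrite -pq pP.
    rewrite ler_wpM2r ?exprn_ge0 ?(ltW p20)//.
    by rewrite ler_nat -nE size_filter count_size.
  apply: sum_le_size => p _.
  apply: lerXn2r; rewrite ?nnegrE; [exact: ltW (Phi0 _ (dl_gt0 p))| |].
    by rewrite -p0E; exact: ltW (Phi0 _ l0_gt0).
  by rewrite -p0E; apply: (Phi_antitone fDP) => //; exact: dl_ge.
- by rewrite /ds_space nE LE; exact: (space_bound p20 p21 p10 p01 n1 c0 B1 lnB).
Qed.
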